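(* There exists a perfect pruned incompressible tree $T\leq_T\emptyset''$ which is not a member of any deep $\Pi^0_1$ class.
   Context: $2^\omega$ is Cantor space, $2^{<\omega}$ the set of finite binary strings, $2^n$ the set of $n$-bit strings, $2^{\leq n}=\bigcup_{i\leq n}2^i$. $K$ is prefix-free Kolmogorov complexity. A tree is a nonempty set $T\subseteq 2^{<\omega}$ that is downward-closed under the prefix relation $\preceq$. $T$ is pruned if it has no $\preceq$-maximal element; perfect if each string in $T$ has at least two $\preceq$-incomparable strict extensions in $T$; incompressible if $\sup_{\sigma\in T}(|\sigma|-K(\sigma))<\infty$. Deep classes: let $\mathbf{m}$ be a universal (multiplicatively optimal) lower semicomputable discrete semimeasure on $2^{<\omega}$ (e.g. $\mathbf{m}(\sigma)=2^{-K(\sigma)}$). For a $\Pi^0_1$ class $P\subseteq 2^\omega$ let $P_n$ be the set of $n$-bit prefixes of members of $P$ and $\mathbf{m}(P_n)=\sum_{\sigma\in P_n}\mathbf{m}(\sigma)$. $P$ is deep if there is a computable order (nondecreasing unbounded function) $g:\mathbb{N}\to\mathbb{N}$ with $\mathbf{m}(P_n)\leq 2^{-g(n)}$ for all $n$. Coding of trees: let $\mathcal{T}$ be the set of pruned trees. Fix an effective injective coding of the finite tree-prefixes $T\cap 2^{\leq n}$ ($T\in\mathcal{T}$) by binary strings that preserves the prefix relations, with the code of $T\cap 2^{\leq n}$ having length $p_n$ for a computable function $n\mapsto p_n$. This induces an effective homeomorphism of $\mathcal{T}$ (with the topology generated by the sets of all trees having a given tree-prefix) onto an effectively closed subspace of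 $2^\omega$, and trees are identified with their codes; so ''$T$ is a member of a $\Pi^0_1$ class $P$'' means that the code of $T$ is in $P\subseteq 2^\omega$. *)

(* Defs.v *)
From Stdlib Require Cantor.
From mathcomp Require Import all_boot all_order all_algebra.
From mathcomp Require Import all_classical all_reals all_analysis.

Set Implicit Arguments.
Unset Strict Implicit.
Unset Printing Implicit Defensive.

Import Order.TTheory GRing.Theory Num.Theory.

Local Open Scope classical_set_scope.

Definition npair (x y : nat) : nat := Cantor.to_nat (x, y).
Definition nfst (x : nat) : nat := (Cantor.of_nat x).1.
Definition nsnd (x : nat) : nat := (Cantor.of_nat x).2.

(* Kleene's partial recursive functions in one variable, several arguments
   being packed with the Cantor pairing function. *)
Inductive prog : Type :=
| Zero
| Succ
| Fst
| Snd
| Oracle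
| Pair of prog & prog
| Comp of prog & prog
| Prec of prog & prog
| Mu of prog.

(* [computes A c x y]: with oracle A, program c halts on input x with output y.
   In the [Prec] case v lists the successive values of the recursion; in the
   [Mu] case y is the least zero, all earlier values being defined. *)
Fixpoint computes (A : set nat) (c : prog) (x y : nat) {struct c} : Prop :=
  match c with
  | Zero => y = 0
  | Succ => y = x.+1
  | Fst => y = nfst x
  | Snd => y = nsnd x
  | Oracle => y = `[< A x >]
  | Pair f g =>
      exists u v, [/\ computes A f x u, computes A g x v & y = npair u v]
  | Comp f g => exists2 z, computes A g x z & computes A f z y
  | Prec f g =>
      exists v : nat -> nat,
        [/\ computes A f (nfst x) (v 0),
            forall i, i < nsnd x ->
              computes A g (npair (nfst x) (npair i (v i))) (v i.+1)
          & y = v (nsnd x)]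
  | Mu f =>
      computes A f (npair x y) 0 /\
      forall i, i < y -> exists k, computes A f (npair x i) k.+1
  end.

Definition halts (A : set nat) (c : prog) (x : nat) : Prop :=
  exists y, computes A c x y.

Definition computable (f : nat -> nat) : Prop :=
  exists c, forall n, computes set0 c n (f n).

Definition ce (W : set nat) : Prop :=
  exists c, forall n, W n <-> halts set0 c n.

Definition turing_le (B A : set nat) : Prop :=
  exists c, forall n, computes A c n `[< B n >].

Fixpoint gnum (c : prog) : nat :=
  match c with
  | Zero => 0
  | Succ => 1
  | Fst => 2
  | Snd => 3
  | Oracle => 4
  | Pair f g => 5 + 4 * npair (gnum f) (gnum g)
  | Comp f g => 6 + 4 * npair (gnum f) (gnum g)
  | Prec f g => 7 + 4 * npair (gnum f) (gnum g)
  | Mu f => 8 + 4 * gnum f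
  end.

Definition jump (A : set nat) : set nat :=
  [set e | exists2 c, gnum c = e & halts A c e].

Notation string := (seq bool).

(* Bijective base-2 numeration, least significant digit first. *)
Fixpoint str_num (s : string) : nat :=
  if s is b :: s' then (str_num s').*2 + b.+1 else 0.

Definition is_tree (T : set string) : Prop :=
  T !=set0 /\ forall s t, T t -> prefix s t -> T s.

Definition strict_prefix (s t : string) : bool := prefix s t && (s != t).

Definition incomparable (s t : string) : bool :=
  ~~ prefix s t && ~~ prefix t s.

Definition pruned (T : set string) : Prop :=
  ~ exists2 s, T s & forall t, T t -> ~~ strict_prefix s t.

Definition perfect (T : set string) : Prop :=
  forall s, T s -> exists t u,
    [/\ T t, T u, strict_prefix s t, strict_prefix s u & incomparable t u].

Definition pruned_tree (T : set string) : Prop := is_tree T /\ pruned T.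

Definition tree_prefix (T : set string) (n : nat) : set string :=
  T `&` [set s | size s <= n].

(* Strong index of a finite set; the sum is 0 by convention if D is infinite. *)
Definition canonical_index (D : set string) : nat :=
  \big[addn/0]_(s \in D) 2 ^ str_num s.

Record tree_coding := TreeCoding {
  tcode :> set string -> string ;
  tlen : nat -> nat ;
  tlen_computable : computable tlen ;
  tcode_computable : exists c, forall T n, pruned_tree T ->
    computes set0 c (canonical_index (tree_prefix T n))
      (str_num (tcode (tree_prefix T n))) ;
  tcode_size : forall T n, pruned_tree T ->
    size (tcode (tree_prefix T n)) = tlen n ;
  tcode_inj : forall T T' n n', pruned_tree T -> pruned_tree T' ->
    tcode (tree_prefix T n) = tcode (tree_prefix T' n') ->
    tree_prefix T n = tree_prefix T' n' ;
  tcode_prefix : forall T T' n n', pruned_tree T -> pruned_tree T' ->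
    n <= n' -> tree_prefix T n = tree_prefix T' n ->
    prefix (tcode (tree_prefix T n)) (tcode (tree_prefix T' n'))
}.

(* The codes of the tree-prefixes of T are compatible; their union is the
   code of T, see [tree_codeP] and [leq_tlen]. *)
Definition tree_code (C : tree_coding) (T : set string) : nat -> bool :=
  fun i => `[< exists n, nth false (C (tree_prefix T n)) i >].

Lemma tree_codeP (C : tree_coding) (T : set string) (n : nat) :
  pruned_tree T -> mkseq (tree_code C T) (tlen C n) = C (tree_prefix T n).
Proof.
move=> pT; apply: (@eq_from_nth _ false); rewrite size_mkseq ?tcode_size//.
move=> i ilt; rewrite nth_mkseq//.
apply/asboolP/idP => [[k]|]; last by exists n.
have compat a b : a <= b -> i < tlen C a ->
    nth false (C (tree_prefix T b)) i = nth false (C (tree_prefix T a)) i.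
  move=> ab ia.
  have /prefixP[w ->] := tcode_prefix C pT pT ab erefl.
  by rewrite nth_cat tcode_size// ia.
have [kn|/ltnW nk] := leqP k n; last by rewrite (compat n k).
have [ik|ki] := ltnP i (tlen C k); first by rewrite -(compat k n).
by rewrite nth_default// tcode_size.
Qed.

Lemma pruned_tree_setT : pruned_tree setT.
Proof.
split; first by split; [exists [::]|].
case=> s _ /(_ (rcons s true) I)/negP; apply; rewrite /strict_prefix.
rewrite -cats1 prefix_prefix/=; apply/eqP => /(congr1 size)/eqP.
by rewrite size_cat addn1 -[X in X == _]addn0 -addn1 eqn_add2l.
Qed.

Lemma ltn_tlen (C : tree_coding) : {homo tlen C : n n' / n < n'}.
Proof.
move=> n n' nn'; have pT := pruned_tree_setT.
have /prefixP[w e] := tcode_prefix C pT pT (ltnW nn') erefl.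
have := congr1 size e; rewrite size_cat !tcode_size// => ->.
rewrite -[X in X < _]addn0 ltn_add2l lt0n size_eq0; apply/eqP => w0.
move: e; rewrite w0 cats0 => /(tcode_inj pT pT)/seteqP[/(_ (nseq n' true))].
case=> [|_ /=]; first by split => //=; rewrite size_nseq.
by rewrite size_nseq leqNgt nn'.
Qed.

Lemma leq_tlen (C : tree_coding) (n : nat) : n <= tlen C n.
Proof. by elim: n => // n /leq_ltn_trans; apply; exact: ltn_tlen. Qed.

Definition run (M : prog) (p s : string) : Prop :=
  computes set0 M (str_num p) (str_num s).

Definition prefix_free_machine (M : prog) : Prop :=
  forall p q s t, run M p s -> run M q t -> prefix p q -> p = q.

Section Reals.
Variable R : realType.
Local Open Scope ring_scope.

(* Complexity with respect to M, +oo outside the range of M. *)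
Definition K (M : prog) (s : string) : \bar R :=
  ereal_inf [set (size p)%:R%:E | p in [set p | run M p s]].

Definition universal_machine (U : prog) : Prop :=
  prefix_free_machine U /\
  forall M, prefix_free_machine M ->
    exists k : nat, forall s, (K U s <= K M s + k%:R%:E)%E.

Definition incompressible (U : prog) (T : set string) : Prop :=
  (ereal_sup [set (size s)%:R%:E - K U s | s in T] < +oo)%E.

Definition semimeasure (m : string -> R) : Prop :=
  (forall s, 0 <= m s) /\ (\esum_(s in setT) (m s)%:E <= 1)%E.

(* As m is nonnegative, only nonnegative rationals a / (b + 1) matter. *)
Definition lower_semicomputable (m : string -> R) : Prop :=
  ce [set npair (str_num x.1) (npair x.2.1 x.2.2) |
        x in [set x : string * (nat * nat) |
               x.2.1%:R / x.2.2.+1%:R < m x.1]].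

Definition universal_semimeasure (m : string -> R) : Prop :=
  [/\ semimeasure m, lower_semicomputable m
    & forall m', semimeasure m' -> lower_semicomputable m' ->
        exists k : R, forall s, m' s <= k * m s].

End Reals.

Definition pi01 (P : set (nat -> bool)) : Prop :=
  exists2 W : set nat, ce W &
    P = [set X | forall n, ~ W (str_num (mkseq X n))].

Definition bit_prefixes (P : set (nat -> bool)) (n : nat) : set (n.-tuple bool) :=
  [set s | exists2 X, P X & tval s = mkseq X n].
Arguments bit_prefixes P n : clear implicits.

Definition computable_order (g : nat -> nat) : Prop :=
  [/\ computable g, {homo g : a b / a <= b} & forall k, exists n, k <= g n].

Definition deep (R : realType) (m : string -> R) (P : set (nat -> bool)) : Prop :=
  pi01 P /\
  exists2 g, computable_order g &
    forall n, (\sum_(s : n.-tuple bool | s \in bit_prefixes P n) m s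
               <= 2 ^- g n)%R.

(* Main.v *)
(* The tree is a Silver tree: for a set S of positions and a sequence V of bits,
   it consists of the strings that agree with V outside S.  Finite approximations
   fix S and V up to some length; a continuation Y of V then determines, for the
   same S, a tree with finitely many branches, so one can pick Y at random.  Call Y
   alive if all strings of the resulting tree satisfy |s| <= |p| + 3 for every
   description p of s.  By Kraft's inequality the alive sequences have measure at
   least 7/8 for S empty.  When they have measure at least 7/8 and the next
   position is added to S, measure at least 3/4 remains, since both values of that
   bit must be alive; Lebesgue's density theorem restores the bound 7/8 after a
   suitable finite extension of V.

   If P is deep, almost every Y gives a tree whose code is not in P: the image
   of the uniform measure under Y |-> code, with weight 2^(-G n) at sparse levels n
   where G = g/2 increases, is a lower semicomputable semimeasure, and comparing it
   with m on P_n bounds the measure of the bad Y by O(2^(-G n)).  Hence, as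
   3/4 > 1/4, the extension that restores 7/8 can be chosen so that the code has
   left P.  Stage e does this for the c.e. set W_e whenever the measure of the Y
   that W_e does not remove falls to 1/4 or less at some level; this is a question of
   the form "exists n" over predicates decidable in 0', so 0'' answers it, and 0''
   also decides whether the alive sequences have measure at least 7/8. *)

From Stdlib Require Cantor.
Require Import Defs.
From mathcomp Require Import all_boot all_order all_algebra.
From mathcomp Require Import all_classical all_reals all_analysis.
From mathcomp Require Import zify ring lra.

Set Implicit Arguments.
Unset Strict Implicit.
Unset Printing Implicit Defensive.

Import Order.TTheory GRing.Theory Num.Theory.

Local Open Scope classical_set_scope.

(** * Computability relative to an oracle *)

Lemma nfst_npair x y : nfst (npair x y) = x.
Proof. by rewrite /nfst /npair Cantor.cancel_of_to. Qed.

Lemma nsnd_npair x y : nsnd (npair x y) = y.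
Proof. by rewrite /nsnd /npair Cantor.cancel_of_to. Qed.

Lemma npair_fst_snd z : npair (nfst z) (nsnd z) = z.
Proof. by rewrite /npair /nfst /nsnd -surjective_pairing Cantor.cancel_to_of. Qed.

Lemma npair_inj x y x' y' : npair x y = npair x' y' -> x = x' /\ y = y'.
Proof.
move=> e; split; first by rewrite -(nfst_npair x y) e nfst_npair.
by rewrite -(nsnd_npair x y) e nsnd_npair.
Qed.

Definition npairE := (nfst_npair, nsnd_npair).

Lemma computes_inj A c x y y' :
  computes A c x y -> computes A c x y' -> y = y'.
Proof.
elim: c x y y' => [||||| f IHf g IHg | f IHf g IHg | f IHf g IHg | f IHf] x y y' /=;
  try by move=> -> ->.
- move=> [u [v [fu gv ->]]] [u' [v' [fu' gv' ->]]].
  by rewrite (IHf _ _ _ fu fu') (IHg _ _ _ gv gv').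
- move=> [z gz fz] [z' gz' fz']; rewrite (IHg _ _ _ gz' gz) in fz'.
  exact: IHf fz fz'.
- move=> [v [v0 vS ->]] [v' [v0' vS' ->]].
  suff H i : i <= nsnd x -> v i = v' i by exact: H.
  elim: i => [_|i IHi ix]; first exact: IHf v0 v0'.
  have := vS' _ ix; rewrite -(IHi (ltnW ix)) => vi'.
  exact: IHg (vS _ ix) vi'.
- move=> [fy ylt] [fy' ylt'].
  case: (ltngtP y y') => // [/ylt'|/ylt] [k fk].
  + by have := IHf _ _ _ fy fk.
  + by have := IHf _ _ _ fy' fk.
Qed.

(** The atomic programs have numbers below 5, and the other constructors are told apart by the
    residue modulo 4; linear arithmetic thus settles all mixed cases. *)
Lemma gnum_inj : injective gnum.
Proof.
elim=> [||||| f IHf g IHg | f IHf g IHg | f IHf g IHg | f IHf]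
  [||||| f' g' | f' g' | f' g' | f'] //= e; try (exfalso; lia).
- have /npair_inj[/IHf -> /IHg ->] // :
    npair (gnum f) (gnum g) = npair (gnum f') (gnum g') by lia.
- have /npair_inj[/IHf -> /IHg ->] // :
    npair (gnum f) (gnum g) = npair (gnum f') (gnum g') by lia.
- have /npair_inj[/IHf -> /IHg ->] // :
    npair (gnum f) (gnum g) = npair (gnum f') (gnum g') by lia.
- have /IHf -> // : gnum f = gnum f' by lia.
Qed.

Definition computable_in (A : set nat) (f : nat -> nat) : Prop :=
  exists c, forall n, computes A c n (f n).

Definition decidable_in (A : set nat) (P : nat -> Prop) : Prop :=
  computable_in A (fun z => `[< P z >] : nat).

(** Allows a number to be computed as the count of the indices that pass a decidable test, as is
    done for quotients and for lengths of strings. *)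
Lemma sum_ltn n k : k <= n -> \sum_(i < n) (i < k : nat) = k.
Proof.
elim: n k => [|n IH] k; first by rewrite leqn0 => /eqP ->; rewrite big_ord0.
rewrite leq_eqVlt => /orP[/eqP ->|kn].
  rewrite (eq_bigr (fun=> 1)) => [|i _]; last by rewrite ltn_ord.
  by rewrite sum_nat_const card_ord muln1.
by rewrite big_ord_recr/= IH// ltnNge -ltnS kn addn0.
Qed.

Section Basic.
Variable A : set nat.
Implicit Types (f g h : nat -> nat) (P Q : nat -> Prop).

Lemma eq_computable f g : f =1 g -> computable_in A f -> computable_in A g.
Proof. by move=> e [c cf]; exists c => n; rewrite -e. Qed.

Lemma computable_partial c f g : computable_in A f ->
  (forall z, computes A c (f z) (g z)) -> computable_in A g.
Proof. by move=> [d df] cg; exists (Comp c d) => n; exists (f n). Qed.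

Lemma computable_comp f g : computable_in A f -> computable_in A g -> computable_in A (fun z => f (g z)).
Proof. by move=> [c cf] [d dg]; exists (Comp c d) => n; exists (g n). Qed.

Lemma computable_pair f g : computable_in A f -> computable_in A g -> computable_in A (fun z => npair (f z) (g z)).
Proof. by move=> [c cf] [d dg]; exists (Pair c d) => n; exists (f n), (g n). Qed.

Lemma computable_fst f : computable_in A f -> computable_in A (fun z => nfst (f z)).
Proof. by move=> Af; apply: (@computable_comp nfst) => //; exists Fst. Qed.

Lemma computable_snd f : computable_in A f -> computable_in A (fun z => nsnd (f z)).
Proof. by move=> Af; apply: (@computable_comp nsnd) => //; exists Snd. Qed.

Lemma computable_succ f : computable_in A f -> computable_in A (fun z => (f z).+1).
Proof. by move=> Af; apply: (@computable_comp S) => //; exists Succ. Qed.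

Lemma computable_id : computable_in A (fun z => z).
Proof.
exists (Pair Fst Snd) => n; exists (nfst n), (nsnd n); split=> //.
by rewrite npair_fst_snd.
Qed.

Lemma computable_const k : computable_in A (fun=> k).
Proof. by elim: k => [|k /computable_succ//]; exists Zero. Qed.

End Basic.

Ltac computable_proj := repeat (cbv beta; first [assumption |
  lazymatch goal with
  | |- computable_in _ (fun z => z) => exact computable_id
  | |- computable_in _ nfst => exact (computable_fst (computable_id _))
  | |- computable_in _ nsnd => exact (computable_snd (computable_id _))
  | |- computable_in _ S => exact (computable_succ (computable_id _))
  | |- computable_in _ (fun _ => ?k) => exact: computable_const
  | |- computable_in _ (fun z => nfst (@?f z)) => apply: computable_fst
  | |- computable_in _ (fun z => nsnd (@?f z)) => apply: computable_snd
  | |- computable_in _ (fun z => npair (@?f z) (@?g z)) => apply: computable_pair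
  | |- computable_in _ (fun z => S (@?f z)) => apply: computable_succ
  | H : computable_in ?A ?f |- computable_in ?A (fun z => ?f (@?g z)) =>
      apply: (computable_comp H)
  end]).

(** * Primitive recursion, arithmetic, bounded quantifiers and unbounded search *)

Section Closure.
Variable A : set nat.
Implicit Types (f g h : nat -> nat) (P Q : nat -> Prop).

Lemma computable_iteri f h (g : nat -> nat -> nat -> nat) : computable_in A f -> computable_in A h ->
  computable_in A (fun t => g (nfst t) (nfst (nsnd t)) (nsnd (nsnd t))) ->
  computable_in A (fun z => iteri (h z) (g z) (f z)).
Proof.
move=> [c cf] Ah [d dg].
pose F t := iteri (nsnd t) (g (nfst t)) (f (nfst t)).
apply: (@eq_computable A (fun z => F (npair z (h z)))); first by move=> z; rewrite /F !npairE.
apply: (@computable_comp A F); last exact: computable_pair (computable_id _) Ah.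
exists (Prec c d) => t; exists (fun i => iteri i (g (nfst t)) (f (nfst t))).
by split=> // i _ /=; have := dg (npair (nfst t)
  (npair i (iteri i (g (nfst t)) (f (nfst t))))); rewrite !npairE.
Qed.

Lemma computable_add f g : computable_in A f -> computable_in A g -> computable_in A (fun z => f z + g z).
Proof.
move=> Af Ag; apply: (@eq_computable A (fun z => iteri (g z) (fun _ a => a.+1) (f z))).
  by move=> z; elim: (g z) => [|n /= ->]; rewrite ?addn0 ?addnS.
by apply: (@computable_iteri f g (fun z _ a => a.+1)); computable_proj.
Qed.

Lemma computable_mul f g : computable_in A f -> computable_in A g -> computable_in A (fun z => f z * g z).
Proof.
move=> Af Ag; apply: (@eq_computable A (fun z => iteri (g z) (fun _ a => a + f z) 0)).
  by move=> z; elim: (g z) => [|n /= ->]; rewrite ?muln0 ?mulnS 1?addnC.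
by apply: (@computable_iteri (fun=> 0) g (fun z _ a => a + f z)); do ?apply: computable_add; computable_proj.
Qed.

Lemma computable_exp f g : computable_in A f -> computable_in A g -> computable_in A (fun z => f z ^ g z).
Proof.
move=> Af Ag; apply: (@eq_computable A (fun z => iteri (g z) (fun _ a => a * f z) 1)).
  by move=> z; elim: (g z) => [|n /= ->]; rewrite ?expn0 ?expnSr.
by apply: (@computable_iteri (fun=> 1) g (fun z _ a => a * f z)); do ?apply: computable_mul; computable_proj.
Qed.

Lemma computable_pred f : computable_in A f -> computable_in A (fun z => (f z).-1).
Proof.
move=> Af; apply: (@eq_computable A (fun z => iteri (f z) (fun i _ => i) 0)).
  by move=> z; case: (f z).
by apply: (@computable_iteri (fun=> 0) f (fun z i _ => i)); computable_proj.
Qed.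

Lemma computable_sub f g : computable_in A f -> computable_in A g -> computable_in A (fun z => f z - g z).
Proof.
move=> Af Ag; apply: (@eq_computable A (fun z => iteri (g z) (fun _ a => a.-1) (f z))).
  by move=> z; elim: (g z) => [|n /= ->]; rewrite ?subn0 ?subnS.
by apply: (@computable_iteri f g (fun z _ a => a.-1)); do ?apply: computable_pred; computable_proj.
Qed.

Lemma computable_sum f (g : nat -> nat -> nat) : computable_in A f ->
  computable_in A (fun t => g (nfst t) (nsnd t)) ->
  computable_in A (fun z => \sum_(i < f z) g z i).
Proof.
move=> Af Ag; apply: (@eq_computable A (fun z => iteri (f z) (fun i a => a + g z i) 0)).
  by move=> z; elim: (f z) => [|n /= ->]; rewrite ?big_ord0 ?big_ord_recr.
apply: (@computable_iteri (fun=> 0) f (fun z i a => a + g z i)); computable_proj.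
apply: computable_add; first by computable_proj.
pose G t := g (nfst t) (nsnd t).
apply: (@eq_computable A (fun t => G (npair (nfst t) (nfst (nsnd t))))).
  by move=> t; rewrite /G !npairE.
by apply: (@computable_comp A G) => //; computable_proj.
Qed.

Lemma eq_decidable P Q : (forall z, P z <-> Q z) -> decidable_in A P -> decidable_in A Q.
Proof. by move=> e; apply: eq_computable => z; rewrite (asbool_equiv_eq (e z)). Qed.

Lemma decidable_comp P f : decidable_in A P -> computable_in A f -> decidable_in A (fun z => P (f z)).
Proof. exact: computable_comp. Qed.

Lemma decidable_eq0 f : computable_in A f -> decidable_in A (fun z => f z = 0).
Proof.
move=> Af; apply: (@eq_computable A (fun z => 1 - f z)).
  by move=> z; case: asboolP => /=; lia.
by apply: computable_sub => //; exact: computable_const.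
Qed.

Lemma decidable_not P : decidable_in A P -> decidable_in A (fun z => ~ P z).
Proof.
move=> /decidable_eq0; apply: eq_decidable => z.
by case: asboolP.
Qed.

Lemma decidable_and P Q : decidable_in A P -> decidable_in A Q -> decidable_in A (fun z => P z /\ Q z).
Proof.
move=> AP AQ; apply: (@eq_computable A (fun z => `[< P z >] * `[< Q z >])); last exact: computable_mul.
by move=> z; rewrite asbool_and mulnb.
Qed.

Lemma decidable_or P Q : decidable_in A P -> decidable_in A Q -> decidable_in A (fun z => P z \/ Q z).
Proof.
move=> /decidable_not AP /decidable_not AQ; apply: eq_decidable (decidable_not (decidable_and AP AQ)) => z.
by rewrite not_andE !notK.
Qed.

Lemma decidable_imp P Q : decidable_in A P -> decidable_in A Q -> decidable_in A (fun z => P z -> Q z).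
Proof.
move=> /decidable_not AP AQ; apply: eq_decidable (decidable_or AP AQ) => z.
by rewrite implyE.
Qed.

Lemma decidable_eq f g : computable_in A f -> computable_in A g -> decidable_in A (fun z => f z = g z).
Proof.
move=> Af Ag; have := decidable_eq0 (computable_add (computable_sub Af Ag) (computable_sub Ag Af)).
by apply: eq_decidable => z; split; lia.
Qed.

Lemma decidable_leq f g : computable_in A f -> computable_in A g -> decidable_in A (fun z => f z <= g z).
Proof.
move=> Af Ag; have := decidable_eq0 (computable_sub Af Ag).
by apply: eq_decidable => z; split; lia.
Qed.

Lemma decidable_ltn f g : computable_in A f -> computable_in A g -> decidable_in A (fun z => f z < g z).
Proof. by move=> /computable_succ; exact: decidable_leq. Qed.

Lemma decidable_ball f (P : nat -> nat -> Prop) : computable_in A f ->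
  decidable_in A (fun t => P (nfst t) (nsnd t)) ->
  decidable_in A (fun z => forall i, i < f z -> P z i).
Proof.
move=> Af /decidable_not AP; have := decidable_eq0 (computable_sum (g := fun z i => `[< ~ P z i >]) Af AP).
apply: eq_decidable => z; split.
  move=> /eqP; rewrite sum_nat_eq0 => /forallP/= s i ilt.
  by have := s (Ordinal ilt); rewrite /= eqb0 asbool_neg negbK => /asboolP.
by move=> H; apply: big1 => i _; rewrite asboolF//; apply; exact: H.
Qed.

Lemma decidable_bex f (P : nat -> nat -> Prop) : computable_in A f ->
  decidable_in A (fun t => P (nfst t) (nsnd t)) ->
  decidable_in A (fun z => exists2 i, i < f z & P z i).
Proof.
move=> Af /decidable_not AP.
apply: eq_decidable (decidable_not (decidable_ball (P := fun z i => ~ P z i) Af AP)) => z; split.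
  move=> /existsNP[i /not_implyP[ilt /contrapT Pi]]; by exists i.
by move=> [i ilt Pi] /(_ i ilt).
Qed.

Lemma computable_if P f g : decidable_in A P -> computable_in A f -> computable_in A g ->
  computable_in A (fun z => if `[< P z >] then f z else g z).
Proof.
move=> AP Af Ag.
apply: (@eq_computable A (fun z => `[< P z >] * f z + `[< ~ P z >] * g z)).
  by move=> z; rewrite asbool_neg; case: asboolP => _; rewrite ?mul1n ?mul0n ?addn0.
by apply: computable_add; apply: computable_mul => //; exact: decidable_not.
Qed.

Lemma computable_div f g : computable_in A f -> computable_in A g -> computable_in A (fun z => f z %/ g z).
Proof.
move=> Af Ag.
(* The quotient counts the positive multiples of [g z] up to [f z]; the condition [0 < g z] gives
   the conventional value 0 for division by 0. *)
apply: (@eq_computable A (fun z => \sum_(i < f z) `[< (0 < g z) /\ (i.+1 * g z <= f z) >])).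
  move=> z; set n := f z; set d := g z.
  have [->|d0] := posnP d; first by rewrite divn0 big1// => i _; rewrite asboolF// => -[].
  transitivity (\sum_(i < n) (i < n %/ d)).
    by apply: eq_bigr => i _; rewrite -leq_divRL// asbool_and asboolT//= asboolb.
  exact/sum_ltn/leq_div.
apply: (@computable_sum f (fun z i => `[< (0 < g z) /\ (i.+1 * g z <= f z) >])) => //.
apply: (@decidable_and (fun t => 0 < g (nfst t))
  (fun t => (nsnd t).+1 * g (nfst t) <= f (nfst t))); first by apply: decidable_ltn; computable_proj.
by apply: decidable_leq; do ?apply: computable_mul; computable_proj.
Qed.

Lemma computable_mod f g : computable_in A f -> computable_in A g -> computable_in A (fun z => f z %% g z).
Proof.
move=> Af Ag; apply: (@eq_computable A (fun z => f z - f z %/ g z * g z)).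
  by move=> z; rewrite {1}(divn_eq (f z) (g z)) addKn.
by apply: computable_sub => //; apply: computable_mul => //; exact: computable_div.
Qed.

Lemma decidable_odd f : computable_in A f -> decidable_in A (fun z => odd (f z)).
Proof.
move=> Af; apply: (@eq_decidable (fun z => f z %% 2 = 1)).
  by move=> z; rewrite modn2; case: odd.
by apply: decidable_eq; [apply: computable_mod => //; exact: computable_const|exact: computable_const].
Qed.

Lemma computable_search (P : nat -> nat -> Prop) :
  decidable_in A (fun t => P (nfst t) (nsnd t)) -> (forall z, exists n, P z n) ->
  exists2 f, computable_in A f & forall z, P z (f z).
Proof.
(* [Mu] looks for a zero, so the program searched over decides the negation of [P]. *)
move=> /decidable_not[c cP] ex.
have exb z : exists n, `[< P z n >] by have [n Pn] := ex z; exists n; exact/asboolP.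
exists (fun z => ex_minn (exb z)); last by move=> z; case: ex_minnP => n /asboolP.
exists (Mu c) => z; case: ex_minnP => n /asboolP Pn nmin; split.
  by have := cP (npair z n); rewrite !npairE asboolF.
move=> i ilt; exists 0; have := cP (npair z i); rewrite !npairE asboolT//.
by move=> /asboolP/nmin; rewrite leqNgt ilt.
Qed.

Lemma ce_ex (P : nat -> nat -> Prop) : decidable_in A (fun t => P (nfst t) (nsnd t)) ->
  exists c, forall z, (exists n, P z n) <-> halts A c z.
Proof.
move=> /decidable_not[c cP]; exists (Mu c) => z; split.
  move=> ex; have exb : exists n, `[< P z n >] by have [n Pn] := ex; exists n; exact/asboolP.
  exists (ex_minn exb); case: ex_minnP => n /asboolP Pn nmin; split.
    by have := cP (npair z n); rewrite !npairE asboolF.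
  move=> i ilt; exists 0; have := cP (npair z i); rewrite !npairE asboolT//.
  by move=> /asboolP/nmin; rewrite leqNgt ilt.
move=> [n [c0 _]]; exists n; have := cP (npair z n); rewrite !npairE.
by move=> /(computes_inj c0)/esym/eqP; rewrite eqb0 asbool_neg negbK => /asboolP.
Qed.

End Closure.

Lemma ce_decidable P : decidable_in set0 P -> ce P.
Proof.
move=> dP; have [|c Hc] := @ce_ex set0 (fun z _ => P z).
  by apply: decidable_comp => //; apply: computable_fst; exact: computable_id.
by exists c => n; rewrite -Hc; split=> [|[]]//; exists 0.
Qed.

(** * Oracle substitution and the Turing jump *)

Fixpoint osub (d c : prog) : prog :=
  match c with
  | Oracle => d
  | Pair f g => Pair (osub d f) (osub d g)
  | Comp f g => Comp (osub d f) (osub d g)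
  | Prec f g => Prec (osub d f) (osub d g)
  | Mu f => Mu (osub d f)
  | c => c
  end.

Lemma computes_osub A B d c x y : (forall z, computes B d z `[< A z >]) ->
  computes A c x y -> computes B (osub d c) x y.
Proof.
move=> dA; elim: c x y => [||||| f IHf g IHg | f IHf g IHg | f IHf g IHg | f IHf] x y //=.
- by move=> ->; exact: dA.
- by move=> [u [v [/IHf fu /IHg gv ->]]]; exists u, v.
- by move=> [z /IHg gz /IHf fz]; exists z.
- move=> [v [/IHf v0 vS ->]]; exists v; split=> // i /vS; exact: IHg.
- by move=> [/IHf f0 fS]; split=> // i /fS[k /IHf fk]; exists k.
Qed.

(** Each query to [A] is replaced by a run of the program that decides [A] from [B]. *)
Lemma computable_turing A B f : decidable_in B A -> computable_in A f -> computable_in B f.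
Proof. by move=> [d dA] [c cf]; exists (osub d c) => n; exact: computes_osub (cf n). Qed.

(** Serves to hard-wire an input: the jump only asks about a program run on its own number, and
    composing with [constp x] makes that run ignore its input. *)
Definition constp (k : nat) : prog := iter k (Comp Succ) Zero.

Lemma computes_constp A k x y : computes A (constp k) x y <-> y = k.
Proof.
split; last first.
  by move=> ->; elim: k => //= k IH; exists k.
by elim: k y => //= k IH y [z /IH -> ->].
Qed.

Lemma computable_constp A f : computable_in A f -> computable_in A (fun z => gnum (constp (f z))).
Proof.
move=> Af; apply: (@eq_computable _ (fun z => iteri (f z) (fun _ a => 6 + 4 * npair 1 a) 0)).
  by move=> z; elim: (f z) => //= n ->.
apply: computable_iteri => //; first exact: computable_const.
apply: computable_add; first exact: computable_const.
apply: computable_mul; first exact: computable_const.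
apply: computable_pair; first exact: computable_const.
by do 2?apply: computable_snd; exact: computable_id.
Qed.

Definition halts_num (A : set nat) (e x : nat) : Prop :=
  exists2 c, gnum c = e & halts A c x.

(* [6 + 4 * npair e (gnum (constp x))] is the number of [Comp c (constp x)] when
   [gnum c = e]. *)
Lemma jump_halts_num A e x :
  jump A (6 + 4 * npair e (gnum (constp x))) <-> halts_num A e x.
Proof.
split=> [[c]|[c <- [y cy]]]; last first.
  exists (Comp c (constp x)) => //; exists y, x => //; exact/computes_constp.
case: c => [||||| f g | f g | f g | f] /= e' hc; try (exfalso; lia).
have /npair_inj[fe /gnum_inj gx] : npair (gnum f) (gnum g) = npair e (gnum (constp x)) by lia.
exists f => //; case: hc => y [z]; rewrite gx => /computes_constp -> fy; by exists y.
Qed.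

Lemma decidable_oracle A f : computable_in A f -> decidable_in A (fun z => A (f z)).
Proof. by apply: decidable_comp; exists Oracle. Qed.

Lemma decidable_halts_num A f g : computable_in (jump A) f -> computable_in (jump A) g ->
  decidable_in (jump A) (fun z => halts_num A (f z) (g z)).
Proof.
move=> jf jg; apply: (@eq_decidable _ (fun z => jump A (6 + 4 * npair (f z) (gnum (constp (g z)))))).
  by move=> z; exact: jump_halts_num.
apply: decidable_oracle; apply: computable_add; first exact: computable_const.
apply: computable_mul; first exact: computable_const.
by apply: computable_pair => //; exact: computable_constp.
Qed.

Lemma decidable_halts A c f : computable_in (jump A) f -> decidable_in (jump A) (fun z => halts A c (f z)).
Proof.
move=> jf; have := decidable_halts_num (computable_const _ (gnum c)) jf.
apply: eq_decidable => z; split=> [[d /gnum_inj ->]//|h]; by exists c.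
Qed.

Lemma decidable_jump A : decidable_in (jump A) A.
Proof.
(* A search with a dummy witness halts exactly on the elements of [A]. *)
have [|c Hc] := @ce_ex A (fun z _ => A z).
  by apply: decidable_oracle; apply: computable_fst; exact: computable_id.
have := @decidable_halts A c id (computable_id _).
by apply: eq_decidable => z; rewrite -Hc; split=> [[]|]//; exists 0.
Qed.

Lemma computable_jump A f : computable_in A f -> computable_in (jump A) f.
Proof. exact/computable_turing/decidable_jump. Qed.

(** The jump knows whether the search for a counterexample halts. *)
Lemma decidable_forall_jump A (P : nat -> nat -> Prop) :
  decidable_in A (fun t => P (nfst t) (nsnd t)) -> decidable_in (jump A) (fun z => forall n, P z n).
Proof.
move=> /decidable_not dP; have [c Hc] := @ce_ex A (fun z n => ~ P z n) dP.
have := decidable_not (@decidable_halts A c id (computable_id _)).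
apply: eq_decidable => z; rewrite -Hc; split; last by move=> H [n]; apply.
by move=> H n; apply: contrapT => nP; apply: H; exists n.
Qed.

Lemma decidable_computes c f g : computable_in (jump set0) f -> computable_in (jump set0) g ->
  decidable_in (jump set0) (fun z => computes set0 c (f z) (g z)).
Proof.
move=> jf jg.
pose d := Comp c Fst.
have [e He] : computable_in set0 (fun t => nsnd (nfst t)).
  by apply: computable_snd; apply: computable_fst; exact: computable_id.
have [q Hq] : computable_in set0 (fun t => (nfst t - nsnd t) + (nsnd t - nfst t)).
  by apply: computable_add; apply: computable_sub; do ?[exact: computable_id|apply: computable_fst|apply: computable_snd].
(* On input [npair (f z) (g z)] the program [p] runs [c] on [f z] and compares the output with
   [g z]. The search variable is a dummy: [p] halts at 0 if they agree, and diverges if they differ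
   or if [c] diverges. *)
pose p := Mu (Comp q (Pair (Comp c (Comp Fst Fst)) e)).
have := @decidable_halts set0 p (fun z => npair (f z) (g z)) (computable_pair jf jg).
apply: eq_decidable => z; split.
  move=> [n [[w [u [v [[x [y -> ->] cu] /computes_inj/(_ (He _)) -> ->]]] /computes_inj/(_ (Hq _)) e0] _]].
  rewrite !npairE in cu e0.
  by have <- : u = g z by lia.
move=> cfg; exists 0; split=> //=; exists (npair (g z) (g z)).
  exists (g z), (g z); split=> //; last by have := He (npair (npair (f z) (g z)) 0); rewrite !npairE.
  exists (f z) => //; exists (npair (f z) (g z)); by rewrite !npairE.
have := Hq (npair (g z) (g z)); by rewrite !npairE subnn.
Qed.

(** * Strings as numbers *)

Lemma decidable_eqb A (b b' : nat -> bool) : decidable_in A b -> decidable_in A b' ->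
  decidable_in A (fun z => b z = b' z).
Proof.
move=> Ab Ab'; apply: eq_decidable (decidable_eq Ab Ab') => z; rewrite !asboolb.
by case: (b z); case: (b' z); split.
Qed.

(* Binary expansion of [str_num s + 1]: a leading 1, then the bits of s, the
   head of s being the least significant one. *)
Lemma str_num_cons b s : (str_num (b :: s)).+1 = b + (str_num s).+1.*2.
Proof. by rewrite /= doubleS -!addnn; lia. Qed.

Lemma str_num_bounds s : 2 ^ size s <= (str_num s).+1 < 2 ^ (size s).+1.
Proof.
elim: s => // b s IH; rewrite str_num_cons [size _]/= !(expnS _ _.+1) !expnS -!addnn.
by move: IH; rewrite expnS; case: b; lia.
Qed.

Lemma str_num_inj : injective str_num.
Proof.
elim=> [|b s IH] [|b' s'] //=; rewrite -?addnn; try lia.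
case: b b' => [] [] e; try lia; congr cons; apply: IH; lia.
Qed.

Lemma str_num_surj x : exists s, str_num s = x.
Proof.
have [n] := ubnP x; elim: n x => // n IH [|x] xn; first by exists [::].
have [|s hs] := IH x./2; first by have := odd_double_half x; rewrite -addnn; lia.
exists (odd x :: s); rewrite /= hs; have := odd_double_half x; lia.
Qed.

Definition strof (x : nat) : string := xget [::] [set s | str_num s = x].

Lemma strofK : cancel strof str_num.
Proof. by move=> x; have [s sx] := str_num_surj x; rewrite /strof; case: xgetP => // /(_ s). Qed.

Lemma str_numK : cancel str_num strof.
Proof. by move=> s; apply: str_num_inj; rewrite strofK. Qed.

Lemma size_strof_leq x n : (size (strof x) <= n) = (x.+1 < 2 ^ n.+1).
Proof.
have /andP[lo hi] := str_num_bounds (strof x); rewrite strofK in lo hi.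
apply/idP/idP => [le|lt]; first exact: leq_trans hi (leq_pexp2l _ _).
by have := leq_ltn_trans lo lt; rewrite ltn_exp2l.
Qed.

Lemma size_strof_ltn x n : (size (strof x) < n) = (x.+1 < 2 ^ n).
Proof. by case: n => [|n]; rewrite ?ltn0 ?expn0 // ltnS size_strof_leq. Qed.

(** The length is a binary logarithm, written as a bounded count so that it can be computed. *)
Lemma size_str_num s : size s = \sum_(i < str_num s) `[< 2 ^ i.+1 <= (str_num s).+1 >].
Proof.
have /andP[lo hi] := str_num_bounds s.
have sl : size s <= str_num s by rewrite -ltnS; apply: leq_trans lo; exact: ltn_expl.
move: sl lo hi; set x := str_num s; set k := size s; clearbody x k => kx lo hi.
rewrite (eq_bigr (fun i : 'I_x => (i < k : nat))); last first.
  move=> i _; rewrite asboolb; congr nat_of_bool; apply/idP/idP => h.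
    by have := leq_ltn_trans h hi; rewrite ltn_exp2l.
  by apply: leq_trans lo; rewrite leq_exp2l.
exact/esym/sum_ltn.
Qed.

(** In the expansions with a leading 1, the bits of [s] keep their places and those of [t] are
    shifted by [size s]; the summand on the left makes up for the leading 1 of [s], which
    disappears. *)
Lemma str_num_cat s t :
  (str_num (s ++ t)).+1 + 2 ^ size s = (str_num s).+1 + 2 ^ size s * (str_num t).+1.
Proof.
elim: s => [|b s IH]; first by rewrite /= expn0; lia.
by rewrite cat_cons !str_num_cons [size _]/= expnS -!addnn; lia.
Qed.

Lemma str_num_take s l : l <= size s ->
  (str_num (take l s)).+1 = 2 ^ l + (str_num s).+1 %% 2 ^ l.
Proof.
move=> ls; have := str_num_cat (take l s) (drop l s).
have := str_num_bounds (take l s); rewrite cat_take_drop size_takel// expnS.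
set a := (str_num _).+1; set b := (str_num _).+1; set d := (str_num _).+1 => ab e.
have -> : b = d * 2 ^ l + (a - 2 ^ l) by rewrite mulnC; lia.
by rewrite modnMDl modn_small; lia.
Qed.

Lemma nth_str_num s i : i < size s ->
  nth false s i = odd ((str_num s).+1 %/ 2 ^ i).
Proof.
elim: s i => // b s IH [_|i].
  by rewrite str_num_cons expn0 divn1 oddD odd_double addbF; case: b.
rewrite ltnS => lt; rewrite str_num_cons [nth _ _ _]/= IH// expnS divnMA.
by congr (odd (_ %/ _)); rewrite -muln2 divnDr ?dvdn_mull// mulnK//; case: b.
Qed.

Definition str_computable_in A (S : nat -> string) := computable_in A (fun z => str_num (S z)).

Lemma str_computable_strof A f : computable_in A f -> str_computable_in A (fun z => strof (f z)).
Proof. by move=> Af; apply: (@eq_computable A f) => // z; rewrite strofK. Qed.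

Lemma computable_size A S : str_computable_in A S -> computable_in A (fun z => size (S z)).
Proof.
move=> AS; apply: (@eq_computable A (fun z => \sum_(i < str_num (S z))
    `[< 2 ^ i.+1 <= (str_num (S z)).+1 >])); first by move=> z; rewrite -size_str_num.
apply: (@computable_sum A (fun z => str_num (S z))
  (fun z i => `[< 2 ^ i.+1 <= (str_num (S z)).+1 >])) => //.
apply: decidable_leq; first by apply: computable_exp; computable_proj.
by apply: computable_succ; apply: (computable_comp AS); computable_proj.
Qed.

Lemma decidable_nth A S i : str_computable_in A S -> computable_in A i -> decidable_in A (fun z => nth false (S z) (i z)).
Proof.
move=> AS Ai.
apply: (@eq_decidable A (fun z => i z < size (S z) /\ odd ((str_num (S z)).+1 %/ 2 ^ i z))).
  move=> z; have [lt|ge] := ltnP (i z) (size (S z)); last by rewrite nth_default//; split=> // -[].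
  by rewrite nth_str_num//; split=> // -[].
apply: decidable_and; first exact: decidable_ltn Ai (computable_size AS).
apply: decidable_odd; apply: computable_div; first exact: computable_succ.
by apply: computable_exp => //; exact: computable_const.
Qed.

Lemma str_computable_cat A S T : str_computable_in A S -> str_computable_in A T -> str_computable_in A (fun z => S z ++ T z).
Proof.
move=> AS AT; apply: (@eq_computable A (fun z =>
    ((str_num (S z)).+1 + 2 ^ size (S z) * (str_num (T z)).+1) - 2 ^ size (S z) - 1)).
  by move=> z; rewrite -str_num_cat; lia.
have Ae : computable_in A (fun z => 2 ^ size (S z)).
  by apply: computable_exp; [exact: computable_const|exact: computable_size].
apply: computable_sub; last exact: computable_const; apply: computable_sub => //.
by apply: computable_add; [|apply: computable_mul => //]; exact: computable_succ.
Qed.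

Lemma str_computable_take A l S : computable_in A l -> str_computable_in A S -> str_computable_in A (fun z => take (l z) (S z)).
Proof.
move=> Al AS; apply: (@eq_computable A (fun z => if `[< l z <= size (S z) >]
    then (2 ^ l z + (str_num (S z)).+1 %% 2 ^ l z).-1 else str_num (S z))).
  move=> z; case: asboolP => [le|/negP]; first by rewrite -str_num_take.
  by rewrite -ltnNge => /ltnW/take_oversize ->.
have Ae : computable_in A (fun z => 2 ^ l z) by apply: computable_exp => //; exact: computable_const.
apply: computable_if => //; first exact: decidable_leq Al (computable_size AS).
by apply: computable_pred; apply: computable_add => //; apply: computable_mod => //; exact: computable_succ.
Qed.

Lemma str_computable_rcons A S b : str_computable_in A S -> str_computable_in A (fun z => rcons (S z) b).
Proof.
move=> AS; have : str_computable_in A (fun z => S z ++ [:: b]).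
  by apply: str_computable_cat => //; exact: computable_const.
by rewrite /str_computable_in; apply: eq_computable => z; rewrite cats1.
Qed.

Lemma str_computable_comp A S f : str_computable_in A S -> computable_in A f -> str_computable_in A (fun z => S (f z)).
Proof. exact: computable_comp. Qed.

(** For the indicator of a set this is [2 ^ n] times its density among the continuations of [v] by
    [n] bits. Measures are treated through such integer counts. *)
Fixpoint wsum (F : string -> nat) (n : nat) (v : string) : nat :=
  if n is n'.+1 then wsum F n' (rcons v false) + wsum F n' (rcons v true) else F v.

(** The strings of length [n] are those with numbers from [2 ^ n - 1] to [2 ^ n.+1 - 2]. The first
    bit is the least significant one, so the recursion splits [x] by parity. *)
Lemma wsum_sum F n v :
  wsum F n v = \sum_(x < 2 ^ n) F (v ++ strof ((2 ^ n).-1 + x)).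
Proof.
have split2 k (G : nat -> nat) : \sum_(x < k.*2) G x =
    \sum_(x < k) G x.*2 + \sum_(x < k) G x.*2.+1.
  elim: k => [|k IH]; first by rewrite !big_ord0.
  rewrite doubleS !big_ord_recr/= IH. by rewrite -addnA addnACA.
elim: n v => [|n IH] v /=; first by rewrite expn0 big_ord1 (str_numK [::]) cats0.
have strS (b : bool) x : strof ((2 ^ n.+1).-1 + (b + x.*2)) = b :: strof ((2 ^ n).-1 + x).
  apply: str_num_inj; apply: succn_inj; rewrite str_num_cons !strofK expnS.
  by have := expn_gt0 2 n; rewrite -!addnn; lia.
pose G x := F (v ++ strof ((2 ^ n.+1).-1 + x)).
transitivity (\sum_(x < (2 ^ n).*2) G x); last by rewrite -mul2n -expnS.
rewrite split2 !IH; congr (_ + _); apply: eq_bigr => x _; rewrite /G.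
  by rewrite cat_rcons -(strS false).
by rewrite cat_rcons -(strS true).
Qed.

Lemma computable_wsum A (F : nat -> string -> nat) n S : computable_in A n -> str_computable_in A S ->
  computable_in A (fun t => F (nfst t) (strof (nsnd t))) ->
  computable_in A (fun z => wsum (F z) (n z) (S z)).
Proof.
move=> An AS AF; pose T z x := S z ++ strof ((2 ^ n z).-1 + x).
apply: (@eq_computable A (fun z => \sum_(x < 2 ^ n z) F z (T z x))).
  by move=> z; rewrite wsum_sum.
have Ae : computable_in A (fun z => 2 ^ n z) by apply: computable_exp => //; exact: computable_const.
apply: (@computable_sum A _ (fun z x => F z (T z x))) => //.
pose G t := F (nfst t) (strof (nsnd t)).
apply: (@eq_computable A (fun t => G (npair (nfst t) (str_num (T (nfst t) (nsnd t)))))).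
  by move=> t; rewrite /G !npairE str_numK.
apply: (@computable_comp A G) => //; apply: computable_pair; first by computable_proj.
apply: str_computable_cat; first by apply: (str_computable_comp AS); computable_proj.
apply: str_computable_strof; apply: computable_add; last by computable_proj.
by apply: computable_pred; apply: (computable_comp Ae); computable_proj.
Qed.

(** * Silver trees and the predicates of the construction *)

Lemma computable_set0 A f : computable_in set0 f -> computable_in A f.
Proof.
apply: computable_turing; apply: eq_decidable (decidable_not (decidable_eq
  (computable_const A 0) (computable_const A 0))) => z.
by split=> [|[]]; apply.
Qed.

Ltac computability := repeat (cbv beta; first [assumption |
  lazymatch goal with
  | |- computable_in _ (fun z => z) => exact: computable_id
  | |- computable_in _ nfst => exact (computable_fst (computable_id _))
  | |- computable_in _ nsnd => exact (computable_snd (computable_id _))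
  | |- computable_in _ S => exact (computable_succ (computable_id _))
  | |- computable_in _ (fun _ => ?k) => exact: computable_const
  | |- computable_in _ (fun z => nfst (@?f z)) => apply: computable_fst
  | |- computable_in _ (fun z => nsnd (@?f z)) => apply: computable_snd
  | |- computable_in _ (fun z => npair (@?f z) (@?g z)) => apply: computable_pair
  | |- computable_in _ (fun z => S (@?f z)) => apply: computable_succ
  | |- computable_in _ (fun z => predn (@?f z)) => apply: computable_pred
  | |- computable_in _ (fun z => addn (@?f z) (@?g z)) => apply: computable_add
  | |- computable_in _ (fun z => muln (@?f z) (@?g z)) => apply: computable_mul
  | |- computable_in _ (fun z => subn (@?f z) (@?g z)) => apply: computable_sub
  | |- computable_in _ (fun z => expn (@?f z) (@?g z)) => apply: computable_exp
  | |- computable_in _ (fun z => divn (@?f z) (@?g z)) => apply: computable_div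
  | |- computable_in _ (fun z => size (@?f z)) => apply: computable_size
  | |- computable_in ?A (fun z => str_num (@?f z)) =>
      change (str_computable_in A f)
  | |- computable_in ?A (fun z => nat_of_bool (asbool (@?P z))) =>
      change (decidable_in A P)
  | |- str_computable_in _ (fun _ => ?k) => exact: computable_const
  | |- str_computable_in _ strof => exact (str_computable_strof (computable_id _))
  | |- str_computable_in _ (fun z => strof (@?f z)) => apply: str_computable_strof
  | |- str_computable_in _ (fun z => cat (@?f z) (@?g z)) => apply: str_computable_cat
  | |- str_computable_in _ (fun z => take (@?f z) (@?g z)) => apply: str_computable_take
  | |- str_computable_in _ (fun z => rcons (@?f z) _) => apply: str_computable_rcons
  | |- decidable_in _ (fun z => @?f z /\ @?g z) => apply: decidable_and
  | |- decidable_in _ (fun z => @?f z \/ @?g z) => apply: decidable_or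
  | |- decidable_in _ (fun z => ~ @?f z) => apply: decidable_not
  | |- decidable_in _ (fun z => is_true (leq (@?f z) (@?g z))) => apply: decidable_leq
  | |- decidable_in _ (fun z => is_true (odd (@?f z))) => apply: decidable_odd
  | |- decidable_in _ (fun z => is_true (nth false (@?f z) (@?g z))) => apply: decidable_nth
  | |- decidable_in _ (fun z => @eq bool (@?f z) (@?g z)) => apply: decidable_eqb
  | |- decidable_in _ (fun z => @eq nat (@?f z) (@?g z)) => apply: decidable_eq
  | |- decidable_in _ (fun z => (@?f z) -> (@?g z)) => apply: decidable_imp
  | H : computable_in ?A ?f |- computable_in ?A (fun z => ?f (@?g z)) =>
      apply: (computable_comp H)
  | H : str_computable_in ?A ?f |- str_computable_in ?A (fun z => ?f (@?g z)) =>
      apply: (str_computable_comp H)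
  end]).

Definition bit (M i : nat) : bool := odd (M %/ 2 ^ i).

Definition silver (S V : nat -> bool) : set string :=
  [set s | forall i, i < size s -> S i \/ nth false s i = V i].

(** Beyond the length of [v] the bits default to [false]; it is used for strings of length at most
    [size v]. *)
Definition pattern (S : nat -> bool) (v : string) : set string :=
  silver S (nth false v).

Definition code (C : tree_coding) (S : nat -> bool) (v : string) : string :=
  C (tree_prefix (pattern S v) (size v)).

(** Program number [e] enumerates the strings removed from a class, and the part of the code fixed
    by [v] has a removed prefix. The bound on [l] admits the whole code. *)
Definition killed (C : tree_coding) (e : nat) (S : nat -> bool) (v : string) : Prop :=
  exists2 l, l < (tlen C (size v)).+1 &
    halts_num set0 e (str_num (take l (code C S v))).

Definition bad (U : prog) (s : string) : Prop :=
  exists2 p, size p + 3 < size s & run U p s.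

Definition alive (U : prog) (S : nat -> bool) (v : string) : Prop :=
  forall s, size s <= size v -> pattern S v s -> ~ bad U s.

(* The infinite continuations of v all of whose prefixes are alive have measure
   at least 7/8: [alive] is closed under prefixes, so this measure is the limit of
   a nonincreasing sequence. *)
Definition fat (U : prog) (S : nat -> bool) (v : string) : Prop :=
  forall n, 7 * 2 ^ n <= 8 * wsum (fun s => `[< alive U S s >]) n v.

(* The infinite continuations of v whose code has no prefix in W_e have measure at
   least 1/4. *)
Definition unsettled (C : tree_coding) (e : nat) (S : nat -> bool) (v : string) : Prop :=
  forall n, 2 ^ n < 4 * wsum (fun s => `[< ~ killed C e S s >]) n v.

Lemma silver_pruned S V : pruned_tree (silver S V).
Proof.
split.
  split; first by exists [::].
  move=> s t tT /prefixP[w tE] i si; have := tT i.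
  by rewrite tE size_cat nth_cat si; apply; rewrite ltn_addr.
move=> [s sT /(_ (rcons s (V (size s)))) H].
have /negP : ~~ strict_prefix s (rcons s (V (size s))).
  apply: H => i; rewrite size_rcons ltnS leq_eqVlt nth_rcons => /orP[/eqP ->|si].
    by rewrite ltnn eqxx; right.
  by rewrite si; exact: sT.
apply; rewrite /strict_prefix -cats1 prefix_prefix/=; apply/eqP => /(congr1 size)/eqP.
by rewrite size_cat addn1 eqn_leq ltnn andbF.
Qed.

Lemma eq_tree_prefix S S' V V' n : (forall i, i < n -> S i = S' i /\ V i = V' i) ->
  tree_prefix (silver S V) n = tree_prefix (silver S' V') n.
Proof.
move=> e; apply/seteqP; split=> s [sT sn]; split=> // i si;
  have [eS eV] := e i (leq_trans si sn); by [rewrite -eS -eV; exact: sT|rewrite eS eV; exact: sT].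
Qed.

(** The strings of length at most [n] are those with numbers below [2 ^ n.+1 - 1], so the strong
    index that the coding takes as input is a bounded sum. *)
Lemma canonical_index_prefix T n : canonical_index (tree_prefix T n) =
  \sum_(x < (2 ^ n.+1).-1) `[< T (strof x) >] * 2 ^ x.
Proof.
pose r := [seq s <- map strof (iota 0 (2 ^ n.+1).-1) | `[< T s >]].
have -> : tree_prefix T n = [set` r].
  apply/seteqP; split=> s /=; rewrite mem_filter.
    move=> [Ts sn]; rewrite asboolT//=; apply/mapP; exists (str_num s); last by rewrite str_numK.
    have /= : size (strof (str_num s)) <= n by rewrite str_numK.
    by rewrite size_strof_leq mem_iota add0n; lia.
  move=> /andP[/asboolP Ts /mapP[x]]; rewrite mem_iota add0n => /andP[_ xn] sE.
  by split=> //=; rewrite sE size_strof_leq; lia.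
rewrite /canonical_index -fsbig_seq; last first.
  rewrite filter_uniq// map_inj_uniq ?iota_uniq//; exact: can_inj strofK.
rewrite big_filter big_map -{1}[(2 ^ n.+1).-1]subn0 big_mkcond.
rewrite (big_mkord xpredT (fun x => if `[< T (strof x) >] then 2 ^ str_num (strof x) else 0)).
by apply: eq_bigr => x _; rewrite strofK; case: asboolP; rewrite ?mul1n ?mul0n.
Qed.

(** * Decidability of the predicates in the first and second jump *)

Section Decidability.
Variables (U : prog) (C : tree_coding).

Lemma decidable_pattern A M v s : computable_in A M -> str_computable_in A v ->
  str_computable_in A s -> decidable_in A (fun z => pattern (bit (M z)) (v z) (s z)).
Proof.
move=> AM Av As; rewrite /pattern /silver /bit/=; apply: decidable_ball; computability.
Qed.

Lemma str_computable_code A M v : computable_in A M -> str_computable_in A v ->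
  str_computable_in A (fun z => code C (bit (M z)) (v z)).
Proof.
move=> AM Av.
pose F t := str_num (code C (bit (nfst t)) (strof (nsnd t))).
apply: (@eq_computable A (fun z => F (npair (M z) (str_num (v z))))).
  by move=> z; rewrite /F !npairE str_numK.
apply: (@computable_comp A F); last by computability.
apply: computable_set0; have [c cC] := tcode_computable C.
apply: (@computable_partial set0 c (fun t => canonical_index
    (tree_prefix (pattern (bit (nfst t)) (strof (nsnd t))) (size (strof (nsnd t)))))).
  apply: (eq_computable (fun t => esym (canonical_index_prefix _ _))).
  apply: (@computable_sum set0 _ (fun t x =>
    `[< pattern (bit (nfst t)) (strof (nsnd t)) (strof x) >] * 2 ^ x)).
    by computability.
  computability; apply: decidable_pattern; computability.
by move=> z; apply: cC; exact: silver_pruned.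
Qed.

Lemma decidable_killed e M v : computable_in (jump set0) e ->
  computable_in (jump set0) M -> str_computable_in (jump set0) v ->
  decidable_in (jump set0) (fun z => killed C (e z) (bit (M z)) (v z)).
Proof.
move=> Ae AM Av; have Al := computable_set0 (jump set0) (tlen_computable C).
apply: decidable_bex; first by computability.
apply: decidable_halts_num; computability.
apply: str_computable_code; computability.
Qed.

Lemma decidable_bad s : str_computable_in (jump set0) s ->
  decidable_in (jump set0) (fun z => bad U (s z)).
Proof.
(* Only descriptions shorter than the string matter, and their numbers are below
   [2 ^ size (s z)]. *)
move=> As; apply: (@eq_decidable _ (fun z => exists2 x, x < 2 ^ size (s z) &
    size (strof x) + 3 < size (s z) /\ computes set0 U x (str_num (s z)))).
  move=> z; split=> [[x _ [xs Ux]]|[p ps Up]].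
    by exists (strof x); rewrite // /run strofK.
  exists (str_num p); last by rewrite str_numK.
  have : size (strof (str_num p)) < size (s z) by rewrite str_numK; lia.
  by rewrite size_strof_ltn; lia.
apply: decidable_bex; first by computability.
apply: decidable_and; first by computability.
by apply: decidable_computes; computability.
Qed.

Lemma decidable_alive M v : computable_in (jump set0) M ->
  str_computable_in (jump set0) v ->
  decidable_in (jump set0) (fun z => alive U (bit (M z)) (v z)).
Proof.
move=> AM Av; apply: (@eq_decidable _ (fun z => forall x, x < 2 ^ (size (v z)).+1 ->
    size (strof x) <= size (v z) -> pattern (bit (M z)) (v z) (strof x) -> ~ bad U (strof x))).
  move=> z; split=> H => [s sv|x _]; last exact: H.
  have := H (str_num s); rewrite str_numK; apply=> //.
  have : size (strof (str_num s)) <= size (v z) by rewrite str_numK.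
  by rewrite size_strof_leq; lia.
apply: decidable_ball; first by computability.
apply: decidable_imp; first by computability.
apply: decidable_imp; first by apply: decidable_pattern; computability.
by apply: decidable_not; apply: decidable_bad; computability.
Qed.

Lemma decidable_fat M v : computable_in (jump (jump set0)) M ->
  str_computable_in (jump (jump set0)) v ->
  decidable_in (jump (jump set0)) (fun z => fat U (bit (M z)) (v z)).
Proof.
(* The matrix of the universal statement must be decidable in the first jump, but [M] and [v] are
   computable only in the second. So the statement is decided for packed numbers and then composed
   with [M] and [v]. *)
move=> AM Av; pose P t := fat U (bit (nfst t)) (strof (nsnd t)).
apply: (@eq_decidable _ (fun z => P (npair (M z) (str_num (v z))))).
  by move=> z; rewrite /P !npairE str_numK.
apply: (@decidable_comp _ P); last by computability.
apply: decidable_forall_jump; apply: decidable_leq; first by computability.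
apply: computable_mul; first by computability.
apply: (@computable_wsum _ (fun t s => `[< alive U (bit (nfst (nfst t))) s >])); computability.
by apply: decidable_alive; computability.
Qed.

Lemma decidable_unsettled e M v : computable_in (jump (jump set0)) e ->
  computable_in (jump (jump set0)) M -> str_computable_in (jump (jump set0)) v ->
  decidable_in (jump (jump set0)) (fun z => unsettled C (e z) (bit (M z)) (v z)).
Proof.
move=> Ae AM Av; pose P t := unsettled C (nfst t) (bit (nfst (nsnd t))) (strof (nsnd (nsnd t))).
apply: (@eq_decidable _ (fun z => P (npair (e z) (npair (M z) (str_num (v z)))))).
  by move=> z; rewrite /P !npairE str_numK.
apply: (@decidable_comp _ P); last by computability.
apply: decidable_forall_jump; apply: decidable_ltn; first by computability.
apply: computable_mul; first by computability.
apply: (@computable_wsum _ (fun t s =>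
  `[< ~ killed C (nfst (nfst t)) (bit (nfst (nsnd (nfst t)))) s >])); computability.
by apply: decidable_killed; computability.
Qed.

End Decidability.

(** * Counting extensions of a string *)

Section WeightedSums.
Implicit Types (F G : string -> nat) (D : string -> Prop) (s t v Y : string).

Lemma wsum_shift F n v : wsum F n v = wsum (fun Y => F (v ++ Y)) n [::].
Proof.
rewrite -[v in LHS]cats0; elim: n [::] => [//|n IH] w /=.
by rewrite !rcons_cat !IH.
Qed.

Lemma leq_wsum F G n v : (forall Y, size Y = n -> F (v ++ Y) <= G (v ++ Y)) ->
  wsum F n v <= wsum G n v.
Proof.
elim: n v => [|n IH] v H /=; first by have := H [::] erefl; rewrite cats0.
by apply: leq_add; apply: IH => Y Yn; rewrite cat_rcons; apply: H => /=; rewrite Yn.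
Qed.

Lemma eq_wsum F G n v : (forall Y, size Y = n -> F (v ++ Y) = G (v ++ Y)) ->
  wsum F n v = wsum G n v.
Proof.
move=> H; apply/eqP; rewrite eqn_leq.
by apply/andP; split; apply: leq_wsum => Y Yn; rewrite H.
Qed.

Lemma wsum_const c n v : wsum (fun=> c) n v = c * 2 ^ n.
Proof. by elim: n v => [|n IH] v /=; rewrite ?muln1// !IH expnS; lia. Qed.

Lemma wsum_eq0 F n v : (forall Y, size Y = n -> F (v ++ Y) = 0) -> wsum F n v = 0.
Proof. by move=> H; rewrite -[RHS](mul0n (2 ^ n)) -(wsum_const 0 n v); apply: eq_wsum. Qed.

Lemma wsum_add F G n v : wsum (fun s => F s + G s) n v = wsum F n v + wsum G n v.
Proof. by elim: n v => [//|n IH] v /=; rewrite !IH addnACA. Qed.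

Lemma wsum_mul c F n v : wsum (fun s => c * F s) n v = c * wsum F n v.
Proof. by elim: n v => [//|n IH] v /=; rewrite !IH mulnDr. Qed.

Lemma wsum_big (I : Type) (r : seq I) (Q : pred I) (F : I -> string -> nat) n v :
  wsum (fun s => \sum_(i <- r | Q i) F i s) n v = \sum_(i <- r | Q i) wsum (F i) n v.
Proof. by elim: n v => [//|n IH] v /=; rewrite !IH -big_split. Qed.

Lemma wsum_exchange (F : string -> string -> nat) m n v w :
  wsum (fun s => wsum (F s) m w) n v = wsum (fun t => wsum (F^~ t) n v) m w.
Proof.
elim: n v => [//|n IH] v /=; rewrite !IH -wsum_add.
by apply: eq_wsum.
Qed.

Lemma wsum_cat F m n v : wsum F (m + n) v = wsum (wsum F n) m v.
Proof. by elim: m v => [//|m IH] v; rewrite addSn /= !IH. Qed.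

Lemma wsum_pred1 t n : wsum (fun s => s == t) n [::] = (size t == n).
Proof.
elim: n t => [|n IH] [|c t] //=; rewrite (wsum_shift _ _ [:: false]) (wsum_shift _ _ [:: true]) /=.
  by rewrite !wsum_const.
rewrite eqSS -IH; case: c; last rewrite addnC;
  by rewrite [X in X + _]wsum_eq0//; apply: eq_wsum.
Qed.

Lemma leq_wsum_term F Y : F Y <= wsum F (size Y) [::].
Proof.
have -> : F Y = F Y * (size Y == size Y) by rewrite eqxx muln1.
rewrite -wsum_pred1 -wsum_mul.
by apply: leq_wsum => Z _ /=; case: eqVneq => [->|]; rewrite ?muln1 ?muln0.
Qed.

(** Kraft's inequality: if [v] is in [D], no proper extension is; otherwise the bound splits between
    the two children of [v]. *)
Lemma wsum_kraft D n v : (forall s t, D s -> D (s ++ t) -> t = [::]) ->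
  \sum_(i < n.+1) 2 ^ (n - i) * wsum (fun s => `[< D s >]) i v <= 2 ^ n.
Proof.
move=> Dfree; elim: n v => [|n IH] v.
  by rewrite big_ord1 /= expn0 mul1n leq_b1.
rewrite big_ord_recl subn0 /=; case: asboolP => Dv.
    rewrite big1 ?muln1 ?addn0// => i _; rewrite [X in _ * X](@wsum_eq0 _ (bump 0 i)) ?muln0//.
  by move=> Y Yi; rewrite asboolF// => /(Dfree _ _ Dv) Y0; rewrite Y0 in Yi.
rewrite muln0 add0n.
rewrite expnS mul2n -addnn; apply: leq_trans (leq_add (IH (rcons v false)) (IH (rcons v true))).
rewrite -big_split; apply: leq_sum => i _.
by rewrite /bump /= add1n subSS -mulnDr.
Qed.

Definition prefix_closed D := forall s t, D (s ++ t) -> D s.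

Lemma wsum_closed0 D n v : prefix_closed D -> ~ D v ->
  wsum (fun s => `[< D s >]) n v = 0.
Proof.
move=> Dc Dv; apply: wsum_eq0 => Y _.
by rewrite asboolF// => /Dc.
Qed.

(** A string outside [D] has no extension in [D], and one in [D] has at most [2 ^ n] of them:
    densities do not increase with the level. *)
Lemma leq_wsum_closed D m n v : prefix_closed D ->
  wsum (fun s => `[< D s >]) (m + n) v <= wsum (fun s => `[< D s >]) m v * 2 ^ n.
Proof.
move=> Dc; rewrite wsum_cat mulnC -wsum_mul; apply: leq_wsum => Y _.
case: asboolP => DY; last by rewrite wsum_closed0.
rewrite muln1 -[leqRHS]mul1n -(wsum_const 1 n (v ++ Y)).
by apply: leq_wsum => Z _; exact: leq_b1.
Qed.

(** The level [N] may depend on [Y]; as the density of [D] does not increase, the finitely many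
    levels can be replaced by one that is beyond all of them. *)
Lemma wsum_uniform D (b : string -> nat) a n v : prefix_closed D ->
  (forall Y, size Y = n ->
    exists N, a * wsum (fun s => `[< D s >]) N (v ++ Y) <= 2 ^ N * b (v ++ Y)) ->
  exists N, a * wsum (fun s => `[< D s >]) (n + N) v <= 2 ^ N * wsum b n v.
Proof.
move=> Dc; elim: n v => [|n IH] v H.
  by have [N] := H [::] erefl; rewrite cats0 => HN; exists N.
have HS c : exists N, a * wsum (fun s => `[< D s >]) (n + N) (rcons v c)
    <= 2 ^ N * wsum b n (rcons v c).
  by apply: IH => Y Yn; rewrite cat_rcons; apply: H => /=; rewrite Yn.
have [[N0 H0] [N1 H1]] := (HS false, HS true).
exists (N0 + N1); rewrite addSn /= !mulnDr; apply: leq_add.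
  rewrite addnA (leq_trans (leq_mul (leqnn a) (leq_wsum_closed _ _ _ Dc)))//.
  by rewrite mulnA expnD [leqRHS]mulnAC leq_mul2r H0 orbT.
rewrite [in leqLHS](addnC N0) addnA (leq_trans (leq_mul (leqnn a) (leq_wsum_closed _ _ _ Dc)))//.
by rewrite mulnA expnD -[leqRHS]mulnA [leqRHS]mulnC leq_mul2r H1 orbT.
Qed.

Lemma wsum_half D D' n v : prefix_closed D ->
  (forall N, 3 * 2 ^ N <= 4 * wsum (fun s => `[< D s >]) N v) ->
  4 * wsum (fun s => `[< ~ D' s >]) n v <= 2 ^ n ->
  exists2 Y, D' (v ++ Y) & forall N, 2 ^ N <= 2 * wsum (fun s => `[< D s >]) N (v ++ Y).
Proof.
move=> Dc fatD D'n; apply: contrapT => nY.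
(* Otherwise the density of [D] above [Y] is eventually at most 1/2 where [D'] holds, and it is at
   most 1 elsewhere. The average is then at most 5/8, less than 3/4. *)
have [|N] := @wsum_uniform D (fun s => 4 + 4 * `[< ~ D' s >]) 8 n v Dc; last first.
  rewrite wsum_add wsum_const wsum_mul; have := fatD (n + N).
  by rewrite expnD; have := expn_gt0 2 N; have := expn_gt0 2 n; nia.
move=> Y _; case: asboolP => D'Y.
  exists 0; rewrite expn0 /=; case: `[< D _ >]; lia.
have /existsNP[N HN] : ~ forall N, 2 ^ N <= 2 * wsum (fun s => `[< D s >]) N (v ++ Y).
  by move=> H; apply: nY; exists Y => //; exact: contrapT.
by exists N; move/negP: HN; rewrite -ltnNge; lia.
Qed.

(* The discrete form of Lebesgue's density theorem: otherwise extending all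
   strings of one level far enough multiplies the density of D by 7/8, and
   repeating this six times brings it below 1/2. *)
Lemma wsum_density D v : prefix_closed D ->
  (forall N, 2 ^ N <= 2 * wsum (fun s => `[< D s >]) N v) ->
  exists Y, forall N, 7 * 2 ^ N <= 8 * wsum (fun s => `[< D s >]) N (v ++ Y).
Proof.
move=> Dc fatD; apply: contrapT => nY.
have step n : exists N, 8 * wsum (fun s => `[< D s >]) (n + N) v <=
    2 ^ N * (7 * wsum (fun s => `[< D s >]) n v).
  rewrite -wsum_mul; apply: wsum_uniform => // Y _.
  have [DY|DY] := pselect (D (v ++ Y)); last by exists 0; rewrite wsum_closed0.
  have /existsNP[N HN] : ~ forall N, 7 * 2 ^ N <= 8 * wsum (fun s => `[< D s >]) N (v ++ Y).
    by move=> H; apply: nY; exists Y.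
  by exists N; move/negP: HN; rewrite -ltnNge asboolT//; lia.
have iter k : exists n, 8 ^ k * wsum (fun s => `[< D s >]) n v <= 7 ^ k * 2 ^ n.
  elim: k => [|k [n IH]]; first by exists 0; rewrite expn0 /= !mul1n leq_b1.
  have [N HN] := step n; exists (n + N).
  have := leq_mul (leqnn (8 ^ k)) HN; have := leq_mul (leqnn (7 * 2 ^ N)) IH.
  by rewrite !expnS expnD; lia.
have [n] := iter 6; have := fatD n; have : 0 < 2 ^ n by rewrite expn_gt0.
by rewrite !expnS !expn0; lia.
Qed.

End WeightedSums.

(** * Extending a pattern *)

Section Extension.
Variables (U : prog) (C : tree_coding).
Implicit Types (S : nat -> bool) (s t v Y : string).

Lemma tree_prefix_cat S v Y :
  tree_prefix (pattern S (v ++ Y)) (size v) = tree_prefix (pattern S v) (size v).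
Proof. by apply: eq_tree_prefix => i iv; rewrite nth_cat iv. Qed.

Lemma alive_closed S : prefix_closed (alive U S).
Proof.
move=> v Y aliveY s sv sP; apply: aliveY; first by rewrite size_cat (leq_trans sv)// leq_addr.
have : tree_prefix (pattern S v) (size v) s by split.
by rewrite -(tree_prefix_cat _ _ Y) => -[].
Qed.

(** A longer word has a longer code, which still has the removed prefix. *)
Lemma killed_cat e S v Y : killed C e S v -> killed C e S (v ++ Y).
Proof.
move=> [l lv Wl]; have vY : size v <= size (v ++ Y) by rewrite size_cat leq_addr.
have tl : tlen C (size v) <= tlen C (size (v ++ Y)).
  by move: vY; rewrite leq_eqVlt => /orP[/eqP ->|/(ltn_tlen C)/ltnW].
exists l; first exact: leq_trans lv _.
suff -> : take l (code C S (v ++ Y)) = take l (code C S v) by [].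
have /prefixP[w] := tcode_prefix C (silver_pruned S (nth false v))
  (silver_pruned S (nth false (v ++ Y))) vY (esym (tree_prefix_cat S v Y)).
rewrite -/(code C S (v ++ Y)) -/(code C S v) => ->.
rewrite takel_cat// /code tcode_size//; exact: silver_pruned.
Qed.

(** First reach [Q] while keeping density 1/2 for the alive strings, then restore 7/8 by the density
    theorem; [Q] survives this second extension. *)
Lemma extend_fat (Q : string -> Prop) S v n :
  (forall s t, Q s -> Q (s ++ t)) ->
  (forall N, 3 * 2 ^ N <= 4 * wsum (fun s => `[< alive U S s >]) N v) ->
  4 * wsum (fun s => `[< ~ Q s >]) n v <= 2 ^ n ->
  exists2 Y, Q (v ++ Y) & fat U S (v ++ Y).
Proof.
move=> Qcat H Qn; have [Y QY HY] := wsum_half (@alive_closed S) H Qn.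
have [Z HZ] := wsum_density (@alive_closed S) HY.
by exists (Y ++ Z); rewrite catA//; exact: Qcat.
Qed.

Lemma fat_split S S' v : (forall i, S' i = S i || (i == size v)) -> fat U S v ->
  forall N, 3 * 2 ^ N <= 4 * wsum (fun s => `[< alive U S' s >]) N (rcons v false).
Proof.
move=> S'E fatv N.
(* The bit [false] at the new free position is a placeholder. A string of the new tree has one of
   the two values there, so it belongs to the old pattern with that value. *)
have key Y : alive U S (rcons v false ++ Y) -> alive U S (rcons v true ++ Y) ->
    alive U S' (rcons v false ++ Y).
  move=> a0 a1 s ss sP; case sv : (nth false s (size v)).
    apply: a1; first by move: ss; rewrite !size_cat !size_rcons.
    move=> i /[dup] si /sP; rewrite S'E; have [->|iv] := eqVneq i (size v).
      by right; rewrite sv nth_cat size_rcons leqnn nth_rcons ltnn eqxx.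
    rewrite orbF !nth_cat !size_rcons ltnS => -[->|->]; [by left|right].
    by case: leqP => // iv'; rewrite !nth_rcons ltn_neqAle iv iv'.
  apply: a0 => // i /[dup] si /sP; rewrite S'E; have [->|iv] := eqVneq i (size v).
    by right; rewrite sv nth_cat size_rcons leqnn nth_rcons ltnn eqxx.
  by rewrite orbF.
have := fatv N.+1; rewrite expnS /= !(wsum_shift _ _ (rcons v _)).
set F0 := wsum _ _ _; set F1 := wsum _ _ _; set F := wsum _ _ _.
(* Density 7/8 above [v] means that [F0 + F1] is at least 7/4 of [2 ^ N], which leaves 3/4 of it for
   [F]. *)
have : F0 + F1 <= F + 2 ^ N; last by lia.
rewrite -[2 ^ N]mul1n -(wsum_const 1 N [::]) -!wsum_add; apply: leq_wsum => Y _ /=.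
by case: asboolP => a0; case: asboolP => a1; case: asboolP => //= nk; exfalso; exact/nk/key.
Qed.

(* The bad strings have density at most 1/16, as descriptions are shorter than
   what they describe by at least 4 bits. *)
Lemma fat_nil : prefix_free_machine U -> fat U (fun=> false) [::].
Proof.
move=> Ufree n; pose A v := alive U (fun=> false) v.
pose r p s : nat := `[< run U p s >].
change (7 * 2 ^ n <= 8 * wsum (fun s => `[< A s >]) n [::]).
(* Without free positions the strings of the tree up to length [n] are the prefixes of [v], so a
   union bound applies. *)
have notalive v : size v = n ->
    (`[< ~ A v >] : nat) <= \sum_(j < n.+1) `[< bad U (take j v) >].
  move=> vn; case: asboolP => // /existsNP[s /not_implyP[sv /not_implyP[sP /contrapT sb]]].
  have sE : s = take (size s) v.
    apply: (@eq_from_nth _ false) => [|i si]; first by rewrite size_takel.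
    by have [//|->] := sP i si; rewrite nth_take.
  have sn : size s < n.+1 by rewrite ltnS -vn.
  by rewrite (bigD1 (Ordinal sn))//= -sE asboolT.
have badr j s : j <= n -> size s = j -> (`[< bad U s >] : nat) <=
    \sum_(i < n.+1) (i + 3 < j) * wsum (r^~ s) i [::].
  move=> jn sj; case: asboolP => // -[p ps Up].
  have pn : size p < n.+1 by lia.
  rewrite (bigD1 (Ordinal pn))//= -sj ps mul1n.
  by have := leq_wsum_term (r^~ s) p; rewrite {1}/r asboolT//; lia.
pose D p := exists s, run U p s.
(* A description has at most one output. *)
have rD p : \sum_(j < n.+1) wsum (r p) j [::] <= `[< D p >].
  case: asboolP => [[t Ut]|nD]; last first.
    rewrite big1// => j _; apply: wsum_eq0 => s _; rewrite /r asboolF// => Us.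
    by apply: nD; exists s.
  have sum1 m k : \sum_(j < m) (k == j :> nat) <= (k < m).
    elim: m => [|m IH]; first by rewrite big_ord0.
    by rewrite big_ord_recr/= (leq_trans (leq_add IH (leqnn _)))// ltnS; case: ltngtP.
  apply: leq_trans (leq_trans (sum1 n.+1 (size t)) (leq_b1 _)).
  apply: leq_sum => j _; rewrite -wsum_pred1; apply: leq_wsum => s _ /=.
  rewrite /r; case: asboolP => // Us; rewrite lt0b; apply/eqP/str_num_inj.
  exact: computes_inj Us Ut.
have Dfree s t : D s -> D (s ++ t) -> t = [::].
  move=> [x Ux] [y Uy]; have := Ufree _ _ _ _ Ux Uy (prefix_prefix _ _).
  by move=> /(congr1 size); rewrite size_cat; case: t {Uy} => //= a t; lia.
have total : wsum (fun s => `[< A s >]) n [::] + wsum (fun s => `[< ~ A s >]) n [::] = 2 ^ n.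
  rewrite -wsum_add -[RHS]mul1n -(wsum_const 1 n [::]); apply: eq_wsum => s _.
  by rewrite asbool_neg; case: `[< _ >].
suff : 16 * wsum (fun s => `[< ~ A s >]) n [::] <= 2 ^ n by lia.
apply: leq_trans (wsum_kraft n [::] Dfree).
apply: (@leq_trans (16 * \sum_(j < n.+1) 2 ^ (n - j) * wsum (fun s => `[< bad U s >]) j [::])).
  rewrite leq_mul2l/=.
  apply: (@leq_trans (wsum (fun v => \sum_(j < n.+1) `[< bad U (take j v) >]) n [::])).
    by apply: leq_wsum => v; exact: notalive.
  rewrite wsum_big; apply: leq_sum => -[j /= jn] _.
  rewrite -[in leqLHS](subnKC (jn : j <= n)) wsum_cat -wsum_mul; apply: leq_wsum => s sj.
  rewrite [leqRHS]mulnC -(wsum_const _ (n - j) s); apply: leq_wsum => Y _.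
  by rewrite takel_cat ?sj// -sj take_size.
rewrite big_distrr/=.
apply: (@leq_trans (\sum_(j < n.+1) \sum_(i < n.+1)
    2 ^ (n - i) * wsum (fun p => wsum (r p) j [::]) i [::])).
  apply: leq_sum => -[j /= jn] _.
  apply: (@leq_trans (16 * (2 ^ (n - j) * wsum (fun s => \sum_(i < n.+1)
      (i + 3 < j) * wsum (r^~ s) i [::]) j [::]))).
    by rewrite !leq_mul2l; apply/orP; right; apply/orP; right;
      apply: leq_wsum => s sj; exact: badr.
  rewrite wsum_big big_distrr/= big_distrr/=; apply: leq_sum => -[i /= ilt] _.
  rewrite wsum_mul wsum_exchange; case: ltnP => ij; last by rewrite mul0n !muln0.
  (* Here [i + 4 <= j], hence [16 * 2 ^ (n - j) <= 2 ^ (n - i)]. *)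
  rewrite mul1n mulnA leq_mul2r; apply/orP; right.
  by rewrite -[16]/(2 ^ 4) -expnD leq_exp2l//; lia.
rewrite exchange_big; apply: leq_sum => i _ /=.
rewrite -big_distrr/= leq_mul2l -wsum_big; apply/orP; right.
by apply: leq_wsum => p _; exact: rD.
Qed.
End Extension.

(** * Deep classes are avoided by random patterns *)

Section Koenig.
Variables (C : tree_coding) (e : nat) (S : nat -> bool) (P : set (nat -> bool)).
Hypothesis PE : P = [set X | forall n, ~ halts_num set0 e (str_num (mkseq X n))].

Definition extendible (t : string) : Prop :=
  exists2 X, P X & code C S t = mkseq X (tlen C (size t)).

Lemma not_killed_closed : prefix_closed (fun s => ~ killed C e S s).
Proof. by move=> s t nk; apply: contra_not nk; exact: killed_cat. Qed.

(** König's lemma: if [t] had extensions that are not killed at every level, a path through such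
    strings would give a tree whose code is in [P]. *)
Lemma not_extendible_killed t : ~ extendible t ->
  exists N, wsum (fun s => `[< ~ killed C e S s >]) N t = 0.
Proof.
move=> next; apply: contrapT => /forallNP alw; apply: next.
pose E s := forall N, wsum (fun s => `[< ~ killed C e S s >]) N s <> 0.
(* The path takes [false] whenever this keeps [E]. If both children failed, at levels [N0] and [N1],
   both would have failed at level [N0 + N1], against [E s]. *)
have ES s : E s -> E (rcons s (~~ `[< E (rcons s false) >])).
  move=> Es; case: asboolP => [//|/existsNP[N0 /contrapT H0]] N1 H1.
  apply: (Es (N0 + N1).+1); apply/eqP; rewrite /= addn_eq0 -!leqn0; apply/andP; split.
    by rewrite (leq_trans (leq_wsum_closed _ _ _ not_killed_closed))// H0.
  by rewrite addnC (leq_trans (leq_wsum_closed _ _ _ not_killed_closed))// H1.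
pose path k := iter k (fun s => rcons s (~~ `[< E (rcons s false) >])) t.
have Epath k : E (path k) by elim: k => [//|k IH] /=; exact: ES.
have spath k : size (path k) = size t + k.
  by elim: k => [|k IH]; rewrite ?addn0// addnS -IH size_rcons.
pose V i := nth false (path i.+1) i.
have VE k i : i < size t + k -> V i = nth false (path k) i.
  have mono d l : i < size t + l -> nth false (path (l + d)) i = nth false (path l) i.
    move=> il; elim: d => [|d IH]; first by rewrite addn0.
    by rewrite addnS /= nth_rcons spath addnA ltn_addr.
  move=> ik; rewrite /V; have [le|/ltnW le] := leqP i.+1 k.
    by rewrite -(subnKC le) mono//; lia.
  by rewrite -(mono (i.+1 - k) k)// subnKC.
pose X := tree_code C (silver S V).
have codeX k : code C S (path k) = mkseq X (tlen C (size t + k)).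
  rewrite tree_codeP; last exact: silver_pruned.
  rewrite /code spath; congr (C _); apply: eq_tree_prefix => i ik.
  by rewrite (VE k).
exists X; last by have := codeX 0; rewrite addn0.
(* Level 0 of [E] says that [path n] is not killed, and its code already contains the first [n] bits
   of [X]. *)
rewrite PE => n /= Wn; have : ~ killed C e S (path n).
  by have := Epath n 0; rewrite /=; case: asboolP.
have nl : n <= tlen C (size t + n) by rewrite (leq_trans _ (leq_tlen C _))// leq_addl.
apply; exists n; first by rewrite ltnS spath.
by rewrite codeX -map_take take_iota (minn_idPl nl).
Qed.
End Koenig.

(** * The semimeasure of random codes *)

Section Semimeasure.
Variables (R : realType) (C : tree_coding) (M : nat) (v : string) (g : nat -> nat).
Hypotheses (g_comp : computable g) (g_homo : {homo g : a b / a <= b}).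

Let S := bit M.
(** Halving leaves room: a level of weight [2 ^- G n] is compared with a bound [2 ^- g n], which is
    at most the square of that weight. *)
Let G (n : nat) : nat := g n %/ 2.
Let jumps (n : nat) : Prop := 0 < n /\ G n.-1 < G n.
Let q (n : nat) (s : string) : nat := wsum (fun t => `[< code C S t = s >]) n v.

Local Open Scope ring_scope.

Definition jump_weight (n : nat) : R := if `[< jumps n >] then 2 ^- G n else 0.

(* At a level n where G jumps, the semimeasure spreads the weight 2^(-G n)
   uniformly over the codes of v followed by n arbitrary bits. *)
Definition random_code (s : string) : R :=
  \sum_(n < (size s).+1) jump_weight n * ((q n s)%:R / 2 ^+ n).

Lemma jump_weight_ge0 n : 0 <= jump_weight n.
Proof. by rewrite /jump_weight; case: ifP => // _; rewrite invr_ge0 exprn_ge0. Qed.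

(** Where [G] increases, [2 ^- G n.+1] is at most half of [2 ^- G n], so adding it to [1 - 2 ^- G n]
    gives at most [1 - 2 ^- G n.+1]. *)
Lemma jump_weight_sum n : \sum_(i < n.+1) jump_weight i <= 1 - 2 ^- G n.
Proof.
elim: n => [|n IH].
  rewrite big_ord1 /jump_weight asboolF; last by case.
  by rewrite subr_ge0 invf_le1 ?exprn_gt0// exprn_ege1// ler1n.
rewrite big_ord_recr/=; apply: le_trans (lerD IH (lexx _)) _.
have Gn : (G n <= G n.+1)%N by apply: leq_div2r; exact/g_homo/leqnSn.
rewrite /jump_weight; case: asboolP => [[_ /= lt]|_]; last first.
  by rewrite addr0 lerD2l lerN2 lef_pV2 ?posrE ?exprn_gt0// ler_weXn2l// ler1n.
have : (2 : R) ^- G n.+1 <= 2 ^- (G n).+1.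
  by rewrite lef_pV2 ?posrE ?exprn_gt0// ler_weXn2l// ler1n.
rewrite exprS invfM; lra.
Qed.

(** Codes at level [n] have at least [n] bits, so they satisfy the premise: stopping the sum at
    [size s] loses none of them. *)
Lemma random_code_term n s : (n <= size s)%N ->
  jump_weight n * ((q n s)%:R / 2 ^+ n) <= random_code s.
Proof.
move=> ns; rewrite /random_code (bigD1 (Ordinal (ns : (n < (size s).+1)%N)))//= lerDl.
by apply: sumr_ge0 => i _; rewrite mulr_ge0 ?jump_weight_ge0// divr_ge0// exprn_ge0.
Qed.

Lemma random_code_semimeasure : semimeasure random_code.
Proof.
split=> [s|].
  by apply: sumr_ge0 => i _; rewrite mulr_ge0 ?jump_weight_ge0// divr_ge0// exprn_ge0.
apply: ub_ereal_sup => _ [A [finA _] <-].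
rewrite fsbig_finite//= sumEFin lee_fin.
have : uniq (finmap.enum_fset (fset_set A)) by exact: finmap.fset_uniq.
move: (finmap.enum_fset (fset_set A)) => r ur; set N := (\max_(s <- r) size s)%N.
apply: (@le_trans _ _ (\sum_(s <- r) \sum_(n < N.+1) jump_weight n * ((q n s)%:R / 2 ^+ n))).
  rewrite big_seq [leRHS]big_seq; apply: ler_sum => s sr.
  have sN : ((size s).+1 <= N.+1)%N by rewrite ltnS /N (big_rem s)//= leq_maxl.
  rewrite /random_code (big_ord_widen _ (fun n => jump_weight n * ((q n s)%:R / 2 ^+ n)) sN).
  rewrite big_mkcond; apply: ler_sum => i _; case: ifP => // _.
  by rewrite mulr_ge0 ?jump_weight_ge0// divr_ge0// exprn_ge0.
rewrite exchange_big/=.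
apply: (@le_trans _ _ (\sum_(n < N.+1) jump_weight n)); last first.
  by rewrite (le_trans (jump_weight_sum N))// gerBl invr_ge0 exprn_ge0.
apply: ler_sum => n _; rewrite -mulr_sumr -mulr_suml -natr_sum ler_piMr ?jump_weight_ge0//.
rewrite ler_pdivrMr ?exprn_gt0// mul1r -natrX ler_nat /q -wsum_big.
rewrite -[leqRHS]mul1n -(wsum_const 1 n v); apply: leq_wsum => Y _.
(* Each continuation has a single code, which occurs at most once in [r]; hence level [n]
   contributes at most its weight. *)
have -> : (\sum_(s <- r) `[< code C S (v ++ Y) = s >] = count_mem (code C S (v ++ Y)) r)%N.
  rewrite -sum1_count [RHS]big_mkcond/=; apply: eq_bigr => s _.
  by case: asboolP => [->|/eqP]; rewrite ?eqxx// eq_sym => /negbTE ->.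
by rewrite count_uniq_mem// leq_b1.
Qed.

(** The values are rationals with a computable numerator and the common denominator
    [2 ^ (size s + G (size s))], so the comparison with a rational is even decidable. *)
Lemma random_code_lsc : lower_semicomputable random_code.
Proof.
pose num s := (\sum_(n < (size s).+1)
  `[< jumps n >] * q n s * 2 ^ ((size s - n) + (G (size s) - G n)))%N.
pose den (s : string) := (2 ^ (size s + G (size s)))%N.
have rcE s : random_code s = (num s)%:R / (den s)%:R.
  rewrite /random_code /num /den natr_sum mulr_suml; apply: eq_bigr => -[n /= ns] _.
  have Gn : (G n <= G (size s))%N by apply: leq_div2r; exact: g_homo.
  rewrite /jump_weight !natrM !natrX; case: asboolP => _; last by rewrite !mul0r.
  rewrite mul1r; set d := (size s - n + (G (size s) - G n))%N.
  have -> : (size s + G (size s) = d + (n + G n))%N.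
    by rewrite -{1}(subnK (ns : (n <= size s)%N)) -{1}(subnK Gn) addnACA.
  by rewrite !exprD; field; rewrite !expf_neq0.
have Gcomp : computable_in set0 G.
  by apply: computable_div; [exact: g_comp|computability].
have num_comp : computable_in set0 (fun z => num (strof z)).
  apply: (@computable_sum set0 _ (fun z n => `[< jumps n >] * q n (strof z) *
    2 ^ ((size (strof z) - n) + (G (size (strof z)) - G n)))%N); first by computability.
  apply: computable_mul; last by computability.
  apply: computable_mul; first by rewrite /jumps; computability.
  apply: (@computable_wsum _ (fun t s => `[< code C S s = strof (nfst t) >])); try computability.
  apply: (@eq_decidable _ (fun t => str_num (code C S (strof (nsnd t))) = nfst (nfst t))).
    by move=> t; split=> [<-|->]; rewrite ?str_numK ?strofK.
  by computability; apply: str_computable_code; computability.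
have den_comp : computable_in set0 (fun z => den (strof z)) by rewrite /den; computability.
rewrite /lower_semicomputable.
have -> : [set npair (str_num x.1) (npair x.2.1 x.2.2) | x in
    [set x : string * (nat * nat) | x.2.1%:R / x.2.2.+1%:R < random_code x.1]] =
  [set z | (nfst (nsnd z) * den (strof (nfst z)) < num (strof (nfst z)) * (nsnd (nsnd z)).+1)%N].
  have E s a b : (a%:R / b.+1%:R < random_code s) = (a * den s < num s * b.+1)%N.
    rewrite rcE ltr_pdivrMr ?ltr0n// mulrAC ltr_pdivlMr ?ltr0n ?expn_gt0//.
    by rewrite -!natrM ltr_nat.
  apply/seteqP; split=> z /=; first by move=> [[s [a b]] /=]; rewrite E => ? <-; rewrite !npairE str_numK.
  move=> lt; exists (strof (nfst z), (nfst (nsnd z), nsnd (nsnd z))); rewrite /= ?E//.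
  by rewrite strofK !npair_fst_snd.
apply: ce_decidable; rewrite /mkset; computability.
  by apply: (computable_comp den_comp); computability.
by apply: (computable_comp num_comp); computability.
Qed.


(** The least level at which [G] reaches a given bound above [G 0] is positive and a strict increase
    of [G]. *)
Lemma jump_weight_unbounded K : (forall k, exists n, (k <= g n)%N) ->
  exists2 n, jump_weight n = 2 ^- G n & (K <= G n)%N.
Proof.
move=> gub; pose K' := maxn K (G 0).+1.
have ex : exists n, (K' <= G n)%N.
  by have [n gn] := gub (K' * 2)%N; exists n; rewrite /G leq_divRL.
exists (ex_minn ex); case: ex_minnP => n Kn nmin; last by lia.
rewrite /jump_weight asboolT//; have n0 : (0 < n)%N by case: n Kn {nmin} => //; lia.
split=> //; rewrite ltnNge; apply/negP => Gn.
by have := nmin _ (leq_trans Kn Gn); lia.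
Qed.

Lemma leq_extendible P n : (wsum (fun t => `[< extendible C S P t >]) n v <=
  \sum_(s : (tlen C (size v + n)).-tuple bool | s \in bit_prefixes P (tlen C (size v + n))) q n s)%N.
Proof.
rewrite /q -wsum_big; apply: leq_wsum => Y Yn; case: asboolP => // -[X PX].
rewrite size_cat Yn => cE.
have sX : size (mkseq X (tlen C (size v + n))) == tlen C (size v + n) by rewrite size_mkseq.
rewrite (bigD1 (Tuple sX))/=; first by rewrite asboolT.
by apply/mem_set; exists X.
Qed.

End Semimeasure.

Lemma deep_settled (R : realType) (m : string -> R) C e P M v :
  universal_semimeasure m ->
  P = [set X | forall n, ~ halts_num set0 e (str_num (mkseq X n))] ->
  deep m P -> exists n, 4 * wsum (fun s => `[< ~ killed C e (bit M) s >]) n v <= 2 ^ n.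
Proof.
move=> [[m0 _] _ muniv] PE [_ [g [g_comp g_homo g_ub] mP]].
have [k mk] := muniv _ (random_code_semimeasure R C M v g_homo)
  (random_code_lsc R C M v g_comp g_homo).
have [n wn Kn] := jump_weight_unbounded R (Num.bound (4 * `|k|)%R) g_ub.
set G := (g n %/ 2)%N in wn Kn; set p := tlen C (size v + n).
set x := wsum (fun t => `[< extendible C (bit M) P t >]) n v.
have np : n <= p by rewrite (leq_trans _ (leq_tlen C _))// leq_addl.
have x4 : 4 * x <= 2 ^ n.
  (* The left side is at most the [random_code] mass of the prefixes of [P] of length [p], hence at
     most [|k|] times their mass under [m]. So the density of the extendible strings is at most
     [|k| * 2 ^- G], and [n] was chosen with [4 * |k| < 2 ^+ G]. *)
  have : (2 ^- G * (x%:R / 2 ^+ n) <= `|k| * 2 ^- (G + G) :> R)%R.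
    have gp : G + G <= g p.
      by rewrite addnn -muln2 (leq_trans (leq_divM _ _))//; exact: g_homo.
    apply: (@le_trans _ _ (`|k| * 2 ^- g p)%R); last first.
      by rewrite ler_wpM2l// lef_pV2 ?posrE ?exprn_gt0// ler_weXn2l// ler1n.
    apply: le_trans (ler_wpM2l (normr_ge0 k) (mP p)).
    apply: (@le_trans _ _ (\sum_(s : p.-tuple bool | s \in bit_prefixes P p)
        random_code R C M v g s)%R).
      apply: (@le_trans _ _ (\sum_(s : p.-tuple bool | s \in bit_prefixes P p)
        2 ^- G * ((wsum (fun t => `[< code C (bit M) t = s >]) n v)%:R / 2 ^+ n))%R).
        rewrite -mulr_sumr -mulr_suml -natr_sum ler_wpM2l ?invr_ge0 ?exprn_ge0//.
        by rewrite ler_wpM2r ?invr_ge0 ?exprn_ge0// ler_nat leq_extendible.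
      by apply: ler_sum => s _; rewrite -wn random_code_term// size_tuple.
    rewrite mulr_sumr; apply: ler_sum => s _; apply: le_trans (mk s) _.
    by rewrite ler_wpM2r// ?ler_norm// m0.
  rewrite exprD invfM [leRHS]mulrCA ler_pM2l ?invr_gt0 ?exprn_gt0// ler_pdivrMr ?exprn_gt0//.
  rewrite mulrAC ler_pdivlMr ?exprn_gt0// => H.
  have kG : (4 * `|k| < 2 ^+ G :> R)%R.
    apply: lt_le_trans (archi_boundP _) _; first by rewrite mulr_ge0.
    by rewrite -natrX ler_nat (leq_trans Kn)// ltnW// ltn_expl.
  rewrite -(ler_nat R) natrM natrX.
  have G0 : (0 < 2 ^+ G :> R)%R by rewrite exprn_gt0.
  have n0 : (0 < 2 ^+ n :> R)%R by rewrite exprn_gt0.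
  by nra.
(* Strings that are not extendible have all extensions killed at some level; at a common level the
   strings not killed therefore have density at most 1/4. *)
have := @wsum_uniform (fun s => ~ killed C e (bit M) s)
  (fun s => `[< extendible C (bit M) P s >]) 1 n v (@not_killed_closed _ _ _).
case=> [Y Yn|N HN].
  case: asboolP => [_|/(not_extendible_killed PE)[N HN]]; last by exists N; rewrite HN.
  by exists 0; rewrite mul1n /= leq_b1.
exists (n + N); move: HN; rewrite mul1n expnD -/x; nia.
Qed.

(** * The construction *)

Lemma bit0 : bit 0 = fun=> false.
Proof. by apply/funext => i; rewrite /bit div0n. Qed.

Lemma bit_add M k i : M < 2 ^ k -> bit (M + 2 ^ k) i = bit M i || (i == k).
Proof.
move=> Mk; rewrite /bit; case: ltngtP => [ik|ki|->].
- rewrite divnDr ?dvdn_exp2l 1?ltnW// -expnB 1?ltnW// oddD oddX subn_eq0 leqNgt ik.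
  by rewrite addbF orbF.
- have ki2 : 2 ^ k.+1 <= 2 ^ i by rewrite leq_exp2l.
  by rewrite !divn_small//; rewrite expnS in ki2; lia.
- by rewrite divnDr// divnn expn_gt0/= (divn_small Mk).
Qed.

Lemma incompressible_of_not_bad (R : realType) U T :
  (forall s, T s -> ~ bad U s) -> incompressible R U T.
Proof.
move=> nbad; apply: (@le_lt_trans _ _ (3%:R%:E)%E); last exact: ltry.
apply: ub_ereal_sup => _ [s Ts <-].
have : ((size s)%:R%:E - 3%:R%:E <= K R U s)%E.
  apply: le_ereal_inf_tmp => _ [p /= Up <-]; rewrite -EFinB lee_fin lerBlDr -natrD ler_nat.
  by rewrite leqNgt; apply/negP => ps; apply: (nbad s Ts); exists p.
(* A string without description has complexity +oo, and the difference is then -oo. *)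
case: (K R U s) => [k| |]; rewrite -?EFinB ?lee_fin//; last by rewrite leNye.
lra.
Qed.

Section Construction.
Variables (R : realType) (U : prog) (C : tree_coding) (f : nat -> nat).

Definition state0 : nat := npair 0 0.

(** A state packs the set of free positions, as a bit mask, with the number of the word. The
    position just after the word becomes free, and [f] chooses the bits that follow. *)
Definition state_step (e st : nat) : nat :=
  npair (nfst st + 2 ^ size (strof (nsnd st)))
    (str_num (rcons (strof (nsnd st)) false ++ strof (f (npair e st)))).

Definition state (e : nat) : nat := iteri e state_step state0.

Definition mask (e : nat) : nat := nfst (state e).
Definition word (e : nat) : string := strof (nsnd (state e)).

Lemma maskS e : mask e.+1 = mask e + 2 ^ size (word e).
Proof. by rewrite /mask /= npairE. Qed.

Lemma wordS e : word e.+1 = rcons (word e) false ++ strof (f (npair e (state e))).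
Proof. by rewrite {1}/word /= npairE str_numK. Qed.

Lemma leq_size_word e : e <= size (word e).
Proof.
elim: e => // e IH; rewrite wordS size_cat size_rcons.
by rewrite (leq_trans _ (leq_addr _ _)).
Qed.

Lemma mask_bound e : mask e < 2 ^ size (word e).
Proof.
elim: e => [|e IH].
  by rewrite /mask /word /= !npairE (str_numK [::]).
rewrite maskS wordS size_cat size_rcons addSn expnS expnD.
have : 0 < 2 ^ size (strof (f (npair e (state e)))) by rewrite expn_gt0.
nia.
Qed.

(** Later stages add free positions and bits only beyond the current word. *)
Lemma state_stable e d i : i < size (word e) ->
  bit (mask (e + d)) i = bit (mask e) i /\
  nth false (word (e + d)) i = nth false (word e) i.
Proof.
move=> ie; elim: d => [|d [IHm IHw]]; first by rewrite addn0.
have id : i < size (word (e + d)).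
  elim: d {IHm IHw} => [|d IH]; first by rewrite addn0.
  by rewrite addnS wordS size_cat size_rcons; lia.
rewrite addnS maskS wordS bit_add ?mask_bound// nth_cat size_rcons ltnS ltnW//.
by rewrite nth_rcons id IHm IHw (ltn_eqF id) orbF.
Qed.

(* The bit [i] of the state no longer changes after stage [i.+1]. *)
Definition limit_mask (i : nat) : bool := bit (mask i.+1) i.
Definition limit_word (i : nat) : bool := nth false (word i.+1) i.
Definition limit_tree : set string := silver limit_mask limit_word.

Lemma limitE e i : i < size (word e) ->
  limit_mask i = bit (mask e) i /\ limit_word i = nth false (word e) i.
Proof.
move=> ie; rewrite /limit_mask /limit_word.
have [le|le] := leqP i.+1 e.
  by rewrite -(subnKC le); have [-> ->] := state_stable (e - i.+1) (leq_size_word i.+1).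
by have := state_stable (i.+1 - e) ie; rewrite (subnKC (ltnW le)).
Qed.

Lemma limit_tree_prefix e : tree_prefix limit_tree (size (word e)) =
  tree_prefix (pattern (bit (mask e)) (word e)) (size (word e)).
Proof. by apply: eq_tree_prefix => i; exact: limitE. Qed.

Lemma limit_tree_word e s : size s <= size (word e) ->
  limit_tree s <-> pattern (bit (mask e)) (word e) s.
Proof.
move=> se; split=> Ts.
  have : tree_prefix limit_tree (size (word e)) s by split.
  by rewrite limit_tree_prefix => -[].
have : tree_prefix (pattern (bit (mask e)) (word e)) (size (word e)) s by split.
by rewrite -limit_tree_prefix => -[].
Qed.

Lemma limit_tree_perfect : perfect limit_tree.
Proof.
(* Stage [size s] frees the position [k], which is not below [size s]: follow the limit word from
   [s] to [k] and branch there. *)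
move=> s Ts; set k := size (word (size s)).
have sk : size s <= k by exact: leq_size_word.
have maskk : limit_mask k.
  have kS : k < size (word (size s).+1) by rewrite wordS size_cat size_rcons ltnS leq_addr.
  by have [-> _] := limitE kS; rewrite maskS bit_add ?mask_bound// eqxx orbT.
pose t b := s ++ rcons (mkseq (fun j => limit_word (size s + j)) (k - size s)) b.
have tT b : limit_tree (t b).
  move=> i; rewrite /t size_cat size_rcons size_mkseq addnS subnKC// ltnS nth_cat => ik.
  case: ltnP => [|si]; first exact: Ts.
  rewrite nth_rcons size_mkseq; have [lt|le] := ltnP (i - size s) (k - size s).
    by rewrite nth_mkseq// subnKC//; right.
  have -> : i = k by lia.
  by left.
have strict b : strict_prefix s (t b).
  rewrite /strict_prefix prefix_prefix/=; apply/eqP => /(congr1 size).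
  by rewrite size_cat size_rcons; lia.
have neq b : ~~ prefix (t b) (t (~~ b)).
  apply/negP; rewrite prefixE; have -> : size (t b) = size (t (~~ b)).
    by rewrite !size_cat !size_rcons.
  rewrite take_size /t eqseq_cat// eqxx/= eqseq_rcons eqxx/=.
  by case: b.
by exists (t true), (t false); split=> //; rewrite /incomparable (neq true) (neq false).
Qed.

(** Stage [e] must keep the invariant [fat] and kill with [e] unless the new pattern is unsettled.
    The invariant as premise makes a solution exist for every [z], so that the search for it is
    total. *)
Definition extension_spec (z y : nat) : Prop :=
  let e := nfst z in let M := nfst (nsnd z) in let v := strof (nsnd (nsnd z)) in
  let M' := M + 2 ^ size v in let v' := rcons v false ++ strof y in
  M < 2 ^ size v /\ fat U (bit M) v ->
  fat U (bit M') v' /\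
  (killed C e (bit M') v' \/ unsettled C e (bit M') (rcons v false)).

Lemma decidable_extension_spec : decidable_in (jump (jump set0))
  (fun t => extension_spec (nfst t) (nsnd t)).
Proof.
rewrite /extension_spec; apply: decidable_imp; [apply: decidable_and|apply: decidable_and].
- by computability.
- by apply: decidable_fat; computability.
- by apply: decidable_fat; computability.
- apply: decidable_or; last by apply: decidable_unsettled; computability.
  pose P t := killed C (nfst t) (bit (nfst (nsnd t))) (strof (nsnd (nsnd t))).
  have Pdec : decidable_in (jump set0) P by apply: decidable_killed; computability.
  apply: (@eq_decidable _ (fun t => P (npair (nfst (nfst t)) (npair
    (nfst (nsnd (nfst t)) + 2 ^ size (strof (nsnd (nsnd (nfst t)))))
    (str_num (rcons (strof (nsnd (nsnd (nfst t)))) false ++ strof (nsnd t))))))).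
    by move=> t; rewrite /P !npairE str_numK.
  by apply: (decidable_comp (computable_jump Pdec)); computability.
Qed.

Lemma extension_exists z : exists y, extension_spec z y.
Proof.
rewrite /extension_spec /=; set e := nfst z; set M := nfst _; set v := strof _.
have [[Mv fatv]|nfat] := pselect (M < 2 ^ size v /\ fat U (bit M) v); last by exists 0.
have fat34 := fat_split (fun i => bit_add i Mv) fatv.
have [uns|/existsNP[n /negP]] := pselect (unsettled C e (bit (M + 2 ^ size v)) (rcons v false)).
  (* In the unsettled case only the density 7/8 has to be restored, so [Q] is trivial. *)
  have [//||Y _ fatY] := @extend_fat U (fun=> True) _ _ 0 _ fat34.
    by rewrite /= asboolF//; apply.
  by exists (str_num Y); rewrite str_numK => _; split=> //; right.
rewrite -leqNgt => settled.
have [|Y kY fatY] := extend_fat _ fat34 settled; first by move=> s t; exact: killed_cat.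
by exists (str_num Y); rewrite str_numK => _; split=> //; left.
Qed.

Hypothesis Ufree : prefix_free_machine U.
Hypothesis fP : forall z, extension_spec z (f z).

Lemma state_fat e : fat U (bit (mask e)) (word e).
Proof.
elim: e => [|e IH].
  by rewrite /mask /word /= !npairE (str_numK [::]) bit0; exact: fat_nil.
have := @fP (npair e (state e)); rewrite /extension_spec /= !npairE.
rewrite -/(mask e) -/(word e) -maskS -wordS => /(_ (conj (mask_bound e) IH)).
by case.
Qed.

Lemma limit_tree_not_bad s : limit_tree s -> ~ bad U s.
Proof.
have se := leq_size_word (size s); move=> /(limit_tree_word se) Ts.
(* Level 0 of [fat] says that the word itself is alive. *)
have := state_fat (size s) 0; rewrite /= expn0; case: asboolP => // al _.
exact: al.
Qed.

Lemma limit_tree_avoids (m : string -> R) P : universal_semimeasure m ->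
  deep m P -> ~ P (tree_code C limit_tree).
Proof.
move=> hm dP; have [[W [c Wc] PE] _] := dP; set e := gnum c.
have We n : W n <-> halts_num set0 e n.
  rewrite Wc; split=> [h|[d /gnum_inj ->]//]; by exists c.
have PE' : P = [set X | forall n, ~ halts_num set0 e (str_num (mkseq X n))].
  by rewrite PE; apply/seteqP; split=> X /= H n; [rewrite -We|rewrite We].
(* Depth excludes the unsettled alternative at stage [e], so that stage has put a removed prefix
   into the code. *)
have [n settled] := deep_settled C (mask e.+1) (rcons (word e) false) hm PE' dP.
have := @fP (npair e (state e)); rewrite /extension_spec /= !npairE.
rewrite -/(mask e) -/(word e) -maskS -wordS.
move=> /(_ (conj (mask_bound e) (state_fat e)))[_ [[l lt kl]|/(_ n)]]; last first.
  by rewrite ltnNge settled.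
rewrite PE' => /(_ l); apply.
suff -> : mkseq (tree_code C limit_tree) l = take l (code C (bit (mask e.+1)) (word e.+1)) by [].
rewrite /code -limit_tree_prefix -tree_codeP; last exact: silver_pruned.
by rewrite -map_take take_iota (minn_idPl _).
Qed.

Lemma limit_tree_turing : computable_in (jump (jump set0)) f ->
  turing_le (str_num @` limit_tree) (jump (jump set0)).
Proof.
move=> fc.
have stc : computable_in (jump (jump set0)) state.
  apply: (@computable_iteri _ (fun=> state0) id (fun _ e st => state_step e st)).
  - exact: computable_const.
  - exact: computable_id.
  - by rewrite /state_step; computability.
apply: (@eq_decidable _ (fun x => pattern (bit (mask x)) (word x) (strof x))); last first.
  by apply: decidable_pattern; rewrite /mask /word; computability.
(* The string with number [x] has length at most [x], so the state after [x] stages decides whether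
   it is in the tree. *)
move=> x; have sx : size (strof x) <= size (word x).
  rewrite (leq_trans _ (leq_size_word x))// size_strof_leq.
  exact: ltn_expl.
rewrite -limit_tree_word//; split=> [Tx|[s Ts <-]]; last by rewrite str_numK.
by exists (strof x) => //; rewrite strofK.
Qed.

End Construction.

Theorem theorem1p8 (R : realType) (U : prog) (m : seq bool -> R)
    (C : tree_coding)
    (hU : universal_machine R U) (hm : universal_semimeasure m) :
  exists T : set (seq bool),
    [/\ is_tree T, perfect T, pruned T & incompressible R U T] /\
    turing_le (str_num @` T) (jump (jump set0)) /\
    (forall P : set (nat -> bool), deep m P -> ~ P (tree_code C T)).
Proof.
have [f fc fP] := computable_search (decidable_extension_spec U C) (extension_exists U C).
have [treeT prunedT] := silver_pruned (limit_mask f) (limit_word f).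
exists (limit_tree f); split; [split=> //|split].
- exact: limit_tree_perfect.
- by apply: incompressible_of_not_bad => s; exact: (limit_tree_not_bad hU.1 fP).
- exact: limit_tree_turing.
- by move=> P; exact: (limit_tree_avoids hU.1 fP hm).
Qed.
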